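(* Let $\kappa$ be a differentiable function on $\mathbb{R}^+$, let $f$ be continuous on $\mathbb{R}^+$ and $C^1$ on $(0,+\infty)$, let $F$ be the antiderivative of $f$ which vanishes at $0$, and let $P(\rho)=\rho f(\rho)-F(\rho)$. Let $(\rho,v)$ be a sufficiently smooth solution, decaying at infinity and with $\rho$ non-vanishing, of the system $$\begin{cases}\partial_tv+v\cdot\nabla v+\nabla f(\rho)=\nabla\Bigl(\kappa(\rho)\Delta\rho+\frac12\kappa'(\rho)|\nabla\rho|^2\Bigr),\\[2pt] \partial_t\rho+\operatorname{div}(\rho v)=0,\end{cases}\qquad x\in\mathbb{R}^d.$$ Then the following hold. 1. The mass $\mathcal{M}:=\int\rho\,dx$ is conserved. 2. The momentum $\mathcal{P}:=\int\rho v\,dx$ is conserved. 3. The angular momentum $\mathcal{A}:=\int x\wedge\rho v\,dx$ is conserved (written here in the case $d=3$). 4. The quantity $\mathcal{X}:=\int x\,\rho\,dx$ satisfies $\dfrac{d\mathcal{X}}{dt}=\mathcal{P}$. 5. The momentum of inertia $\mathcal{I}:=\frac12\int|x|^2\rho\,dx$ satisfies $\dfrac{d\mathcal{I}}{dt}=\mathcal{F}$, where $\mathcal{F}:=\int\rho\,x\cdot v\,dx$. 6. The energy $$\mathcal{H}:=\int\Bigl(\frac12\rho|v|^2+\frac{\kappa(\rho)}2|\nabla\rho|^2+F(\rho)\Bigr)dx$$ is conserved. 7. The quantity $\mathcal{F}=\int\rho\,x\cdot v\,dx$ satisfies $$\frac{d}{dt}\mathcal{F}=2\mathcal{H}+\int\Bigl(d\,P(\rho)-2F(\rho)+\frac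 d2(\rho\kappa)'(\rho)\,|\nabla\rho|^2\Bigr)dx.$$
   Context: The system describes inviscid capillary (Korteweg) fluids: $\rho=\rho(t,x)$ is the density (so $\rho>0$ when non-vanishing), $v=v(t,x)\in\mathbb{R}^d$ the velocity, $\kappa$ the capillarity coefficient and $P$ the pressure. All integrals are over $\mathbb{R}^d$. $(\rho\kappa)'$ denotes the derivative of the function $\rho\mapsto\rho\kappa(\rho)$, i.e. $\kappa(\rho)+\rho\kappa'(\rho)$. ''Sufficiently smooth and decaying at infinity'' means smooth enough, with enough spatial decay, that all the integrals above are finite, differentiation in time under the integral is licit and all integrations by parts are valid without boundary terms. ''Conserved'' means constant in time. *)

(* Defs.v *)
From HB Require Import structures.
From mathcomp Require Import all_boot all_order all_algebra.
From mathcomp Require Import all_classical all_reals all_analysis.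

Set Implicit Arguments.
Unset Strict Implicit.
Unset Printing Implicit Defensive.

Import Order.TTheory GRing.Theory Num.Theory.
Import numFieldNormedType.Exports.

Local Open Scope classical_set_scope.
Local Open Scope ring_scope.

Section sigma_finite_pushforward.
Context d1 d2 (T1 : measurableType d1) (T2 : measurableType d2) (R : realType).
Local Open Scope ereal_scope.

Lemma sigma_finite_product (m1 : {sigma_finite_measure set T1 -> \bar R})
    (m2 : {sigma_finite_measure set T2 -> \bar R}) :
  sigma_finite setT (m1 \x m2).
Proof.
have /sigma_finiteP[F [TF ndF Foo]] := sigma_finiteT m1.
have /sigma_finiteP[G [TG ndG Goo]] := sigma_finiteT m2.
exists (fun n => F n `*` G n).
  rewrite -setXTT TF TG predeqE => -[x y]; split.
    move=> [/= [n _ Fnx] [k _ Gky]]; exists (maxn n k) => //; split.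
    - by move: x Fnx; exact/subsetPset/ndF/leq_maxl.
    - by move: y Gky; exact/subsetPset/ndG/leq_maxr.
  by move=> [n _ []/= ? ?]; split; exists n.
move=> k; have [? ?] := Foo k; have [? ?] := Goo k.
split; first exact: measurableX.
by rewrite product_measure1E// lte_mul_pinfty// ge0_fin_numE.
Qed.

Lemma sigma_finite_pushforward (m : {measure set T1 -> \bar R})
    (f : T1 -> T2) (g : T2 -> T1) : sigma_finite setT m ->
  measurable_fun setT f -> measurable_fun setT g -> cancel f g ->
  exists m' : {sigma_finite_measure set T2 -> \bar R}, pushforward m f = m'.
Proof.
move=> [G GT Goo] mf mg fK; have [mu muE] : exists mu, mu = pushforward m f by exists (pushforward m f).
have mu0 : mu set0 = 0 by rewrite muE; exact: measure0.
have mu_ge0 A : 0 <= mu A by rewrite muE; exact: measure_ge0.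
have mu_add : semi_sigma_additive mu by rewrite muE; exact: measure_semi_sigma_additive.
have mu_sf : sigma_finite setT mu.
  exists (fun i => g @^-1` G i); first by rewrite -preimage_bigcup -GT preimage_setT.
  move=> i; have [mG Gfin] := Goo i; split.
    by rewrite -[X in measurable X]setTI; exact: mg.
  rewrite muE /pushforward -comp_preimage (_ : g \o f = id)//.
  by apply/funext => x /=; rewrite fK.
pose H1 := isMeasure.Build _ _ _ mu mu0 mu_ge0 mu_add.
pose mu1 : {measure set T2 -> \bar R} := HB.pack mu H1.
pose H2 := Measure_isSigmaFinite.Build _ _ _ mu1 mu_sf.
pose mu2 : {sigma_finite_measure set T2 -> \bar R} := HB.pack (Measure.sort mu1) H2.
by exists mu2; rewrite -muE.
Qed.

End sigma_finite_pushforward.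

(* Lebesgue measure on R^n.  The library only equips n.-tuple R with its
   product (Borel) sigma-algebra; the measure is transported along
   R x R^n ~ R^(n+1), starting from the unit mass on R^0.  Points of R^n are
   row vectors elsewhere, because these carry the normed space structure. *)
Section lebesgue_Rn.
Context {R : realType}.
Local Open Scope ereal_scope.

Definition cons_pair n (p : measurableTypeR R * n.-tuple (measurableTypeR R)) :
  n.+1.-tuple (measurableTypeR R) := [tuple of p.1 :: p.2].

Fixpoint lebesgue_Rn n : set (n.-tuple (measurableTypeR R)) -> \bar R :=
  match n with
  | 0 => \d_([tuple] : 0.-tuple (measurableTypeR R))
  | m.+1 => pushforward (lebesgue_measure \x @lebesgue_Rn m) (@cons_pair m)
  end.

Lemma measurable_cons_pair n : measurable_fun [set: _] (@cons_pair n).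
Proof. exact: measurable_cons. Qed.

Lemma measurable_uncons n : measurable_fun [set: _]
  (fun x : n.+1.-tuple (measurableTypeR R) => (thead x, [tuple of behead x])).
Proof.
apply: measurable_fun_pair; last exact: measurable_behead.
exact: measurable_tnth.
Qed.

Lemma lebesgue_Rn_sigma_finite_measure n :
  exists m : {sigma_finite_measure set (n.-tuple (measurableTypeR R)) -> \bar R},
    @lebesgue_Rn n = m.
Proof.
elim: n => [|n [m IH]] /=.
  by exists (\d_([tuple] : 0.-tuple (measurableTypeR R))).
rewrite IH.
apply: (sigma_finite_pushforward (sigma_finite_product lebesgue_measure m)
  (@measurable_cons_pair n) (@measurable_uncons n)).
by move=> [a b]; rewrite theadE; congr pair; exact/val_inj.
Qed.

Let lebesgue_Rn0 n : @lebesgue_Rn n set0 = 0.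
Proof. by have [m ->] := lebesgue_Rn_sigma_finite_measure n; exact: measure0. Qed.

Let lebesgue_Rn_ge0 n A : 0 <= @lebesgue_Rn n A.
Proof. by have [m ->] := lebesgue_Rn_sigma_finite_measure n; exact: measure_ge0. Qed.

Let lebesgue_Rn_semi_sigma_additive n : semi_sigma_additive (@lebesgue_Rn n).
Proof.
by have [m ->] := lebesgue_Rn_sigma_finite_measure n; exact: measure_semi_sigma_additive.
Qed.

HB.instance Definition _ n := isMeasure.Build _ _ _ (@lebesgue_Rn n)
  (@lebesgue_Rn0 n) (@lebesgue_Rn_ge0 n) (@lebesgue_Rn_semi_sigma_additive n).

Let lebesgue_Rn_sigma_finite n : sigma_finite setT (@lebesgue_Rn n).
Proof. by have [m ->] := lebesgue_Rn_sigma_finite_measure n; exact: sigma_finiteT. Qed.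

HB.instance Definition _ n := Measure_isSigmaFinite.Build _ _ _ (@lebesgue_Rn n)
  (@lebesgue_Rn_sigma_finite n).

End lebesgue_Rn.

Section euler_korteweg.
Context {R : realType} {d : nat}.

Local Notation point := (R * 'rV[R]_d)%type.

Definition rowt (x : d.-tuple (measurableTypeR R)) : 'rV[R]_d :=
  \row_i tnth x i.

Definition int_Rn (g : 'rV[R]_d -> R) : R :=
  \int[@lebesgue_Rn R d]_(x in setT) g (rowt x).

Definition dot (x y : 'rV[R]_d) : R := \sum_i x 0 i * y 0 i.

(* Euclidean, whereas the library's `|x| on row vectors is the sup norm. *)
Definition sqnorm (x : 'rV[R]_d) : R := dot x x.

(* x /\ y as the antisymmetric matrix (x_i y_j - x_j y_i); for d = 3 its
   entries (1,2), (2,0), (0,1) are the components of the cross product. *)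
Definition wedge (x y : 'rV[R]_d) : 'M[R]_d :=
  \matrix_(i, j) (x 0 i * y 0 j - x 0 j * y 0 i).

Definition dir (a : option 'I_d) : point :=
  if a is Some i then (0, delta_mx 0 i) else (1, 0).

(* Space-time partial derivatives: None stands for t, Some i for x_i. *)
Definition pd (a : option 'I_d) (g : point -> R) : point -> R :=
  fun z => 'D_(dir a) g z.

Local Notation dt := (pd None).
Local Notation dx i := (pd (Some i)).

Definition grad (g : point -> R) (z : point) : 'rV[R]_d := \row_i dx i g z.
Definition laplacian (g : point -> R) (z : point) : R :=
  \sum_i dx i (dx i g) z.
Definition comp (u : point -> 'rV[R]_d) (i : 'I_d) : point -> R :=
  fun z => u z 0 i.
Definition div (u : point -> 'rV[R]_d) (z : point) : R :=
  \sum_i dx i (comp u i) z.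

Fixpoint Ck (k : nat) (I : set R) (g : point -> R) : Prop :=
  (forall t x, I t -> {for (t, x), continuous g}) /\
  if k is k'.+1 then
    forall a, (forall t x, I t -> derivable g (t, x) (dir a)) /\
              Ck k' I (pd a g)
  else True.

(* F' = f on [0, +oo[, the derivative at 0 being one-sided. *)
Definition is_antiderivative (f F : R -> R) : Prop :=
  (forall r : R, 0 < r -> is_derive r 1 F (f r)) /\
  h^-1 * (F h - F 0) @[h --> 0^'+] --> f 0.

Definition korteweg (kappa : R -> R) (rho : point -> R) (z : point) : R :=
  kappa (rho z) * laplacian rho z
  + 2^-1 * derive1 kappa (rho z) * sqnorm (grad rho z).

Definition euler_korteweg (I : set R) (kappa f : R -> R)
    (rho : point -> R) (v : point -> 'rV[R]_d) : Prop :=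
  forall t x, I t -> let z := (t, x) in
  (forall j, dt (comp v j) z + \sum_i v z 0 i * dx i (comp v j) z
             + dx j (f \o rho) z = dx j (korteweg kappa rho) z) /\
  dt rho z + div (fun z => rho z *: v z) z = 0.

Definition smooth_solution (I : set R) (kappa : R -> R)
    (rho : point -> R) (v : point -> 'rV[R]_d) : Prop :=
  [/\ Ck 2 I rho, forall j, Ck 1 I (comp v j), Ck 1 I (kappa \o rho),
      Ck 0 I (korteweg kappa rho)
    & forall i, (forall t x, I t ->
                   derivable (korteweg kappa rho) (t, x) (dir (Some i))) /\
                Ck 0 I (dx i (korteweg kappa rho))].

(* Locally uniformly in time, rho and its derivatives are dominated by g, the
   velocity and the capillary terms by w, where (1 + |x|)^2 w^3 g is
   integrable: two factors x and three factors growing with w is the worst that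
   occurs in the integrands below and in their time derivatives and fluxes.
   When v and the capillary terms are bounded, w is a constant.
   The capillary terms are the natural quantities kappa(rho) d rho,
   kappa(rho) d^2 rho and kappa'(rho) d rho d rho rather than kappa(rho) and
   kappa'(rho), as these may blow up where rho goes to 0 (e.g. kappa = 1/rho). *)
Definition decaying_solution (I : set R) (kappa : R -> R)
    (rho : point -> R) (v : point -> 'rV[R]_d) : Prop :=
  forall t0 t1 : R, `[t0, t1]%classic `<=` I ->
  exists (w g : 'rV[R]_d -> R) (M : R),
    [/\ (@lebesgue_Rn R d).-integrable setT
          (fun x => ((1 + `|rowt x|) ^+ 2 * w (rowt x) ^+ 3 * g (rowt x))%:E),
        forall x, 1 <= w x
      & forall t x, t \in `[t0, t1] -> let z := (t, x) in
        [/\ `|rho z| <= M,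
            [/\ `|rho z| <= g x,
                forall a, `|pd a rho z| <= g x
              & forall a b, `|pd a (pd b rho) z| <= g x],
            forall j, `|v z 0 j| <= w x /\
                      forall a, `|pd a (comp v j) z| <= w x
          & [/\ forall a, `|kappa (rho z) * pd a rho z| <= w x,
                forall a b, `|kappa (rho z) * pd a (pd b rho) z| <= w x,
                forall a b, `|derive1 kappa (rho z) * pd a rho z * pd b rho z|
                            <= w x
              & forall i, `|dx i (korteweg kappa rho) z| <= w x]]].

Definition conserved (T : Type) (I : set R) (q : R -> T) : Prop :=
  forall s t, I s -> I t -> q s = q t.

Section quantities.
Variables (rho : point -> R) (v : point -> 'rV[R]_d).

Definition mass (t : R) : R := int_Rn (fun x => rho (t, x)).

Definition momentum (t : R) : 'rV[R]_d :=
  \row_j int_Rn (fun x => (rho (t, x) *: v (t, x)) 0 j).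

Definition angular_momentum (t : R) : 'M[R]_d :=
  \matrix_(i, j) int_Rn (fun x => wedge x (rho (t, x) *: v (t, x)) i j).

Definition first_moment (t : R) : 'rV[R]_d :=
  \row_j int_Rn (fun x => (rho (t, x) *: x) 0 j).

Definition inertia (t : R) : R :=
  2^-1 * int_Rn (fun x => sqnorm x * rho (t, x)).

Definition virial (t : R) : R :=
  int_Rn (fun x => rho (t, x) * dot x (v (t, x))).

Definition energy (kappa F : R -> R) (t : R) : R :=
  int_Rn (fun x => let z := (t, x) in
    2^-1 * rho z * sqnorm (v z)
    + kappa (rho z) / 2 * sqnorm (grad rho z) + F (rho z)).

Definition pressure (f F : R -> R) (r : R) : R := r * f r - F r.

Definition virial_source (kappa f F : R -> R) (t : R) : R :=
  int_Rn (fun x => let z := (t, x) in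
    d%:R * pressure f F (rho z) - 2 * F (rho z)
    + d%:R / 2 * derive1 (fun r => r * kappa r) (rho z) * sqnorm (grad rho z)).

End quantities.

End euler_korteweg.

(* Main.v *)
Require Import Defs.
From mathcomp Require Import all_boot all_order all_algebra.
From mathcomp Require Import all_classical all_reals all_analysis.
From mathcomp Require Import measurable_realfun ring lra.

Import Order.TTheory GRing.Theory Num.Theory.
Import numFieldNormedType.Exports.

Local Open Scope classical_set_scope.
Local Open Scope ring_scope.

Set Implicit Arguments.
Unset Strict Implicit.
Unset Printing Implicit Defensive.

(** Every quantity is the integral of a density q obeying a local balance law
    d_t q = s + div J.  Differentiating under the integral sign and using
    that the divergence of an integrable field with integrable divergence has
    zero integral gives d/dt (int q) = int s.

    The momentum equation is put in conservative form d_t (rho v) + div T = 0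
    with the symmetric stress tensor T = rho v (x) v + kappa grad rho (x) grad rho
    + (P(rho) - rho K - kappa |grad rho|^2 / 2) Id, where K is the Korteweg
    potential.  Momentum is then conserved; angular momentum is because T is
    symmetric; the virial source is the trace of T, up to the divergence of
    d rho kappa grad rho; and the energy flux is
    (rho |v|^2 / 2 + rho f(rho) - rho K) v - kappa (d_t rho) grad rho. *)

(** * Integration by parts in R^n *)

(** The obstacle is vacuum at infinity: rho is positive but may tend to 0, where kappa, kappa' and
    f' may be singular. None of these is therefore estimated alone. kappa(rho) and kappa'(rho)
    always stay multiplied by derivatives of rho, grad f(rho) is bounded through the velocity
    equation, and F(rho) inherits the decay of rho from a linear bound on F near 0.

    Regularity restricts the form of the laws as well: K has space derivatives but no assumed time
    derivative, so it may enter a flux and never a density. The energy law moreover exchanges d_t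
    and d_i on rho; as partial derivatives are directional derivatives, this calls for a proof of
    Schwarz's theorem.

    The weight (1 + |x|)^2 w^3 g is reached: two factors x by the moment of inertia, three factors w
    by the terms rho |v|^2 v and rho f(rho) v of the energy flux. *)

Lemma integrable_small_value d (T : measurableType d) (R : realType)
    (mu : {measure set T -> \bar R}) (h : T -> R) (A : set T) (e : R) :
  mu.-integrable setT (EFin \o h) -> measurable A -> mu A = +oo%E -> 0 < e ->
  exists2 x, A x & `|h x| <= e.
Proof.
(* If |h| > e on all of A, the integral of |h| over A is at least e times the infinite measure of
   A. *)
move=> ih mA Aoo e0; apply: contrapT => /forall2NP hA.
have ihA : mu.-integrable A (EFin \o h) by exact: integrableS ih.
have := integrableP _ _ _ ihA => -[mh]; apply/negP; rewrite -leNgt.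
have <- : (\int[mu]_(x in A) (e%:E))%E = +oo%E.
  by rewrite integral_cst// Aoo gt0_muley.
apply: ge0_le_integral => //=.
- by move=> x _; rewrite lee_fin ltW.
- exact: (measurable_int mu (integrable_abse ihA)).
- move=> x Ax; rewrite lee_fin; have [//|/negP] := hA x.
  by rewrite -ltNge => /ltW.
Qed.

(* An integrable h need not vanish at infinity, but it is small along some
   sequences a n -> -oo and b n -> +oo, and the integral of h' over
   [a n, b n] is h (b n) - h (a n). *)
Lemma integral_derivative_eq0 (R : realType) (h h' : R -> R) :
  (forall x : R, is_derive x 1 h (h' x)) -> continuous h' ->
  lebesgue_measure.-integrable setT (EFin \o h) ->
  lebesgue_measure.-integrable setT (EFin \o h') ->
  (\int[lebesgue_measure]_x (h' x)%:E = 0)%E.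
Proof.
move=> dh ch' ih ih'.
(* The shift by 1 makes [a n < b n] hold for n = 0 too. *)
have hb n : exists b : R, n%:R + 1 <= b /\ `|h b| <= n.+1%:R^-1.
  have [|||b] := @integrable_small_value _ (measurableTypeR R) _ _ h `[n%:R + 1, +oo[ n.+1%:R^-1 ih.
  - exact: measurable_itv.
  - by apply: etrans (lebesgue_measure_itv _) _; rewrite /= ltry.
  - by rewrite invr_gt0.
  by rewrite /= in_itv/= andbT => nb hb; exists b.
have ha n : exists b : R, b <= - n%:R /\ `|h b| <= n.+1%:R^-1.
  have [|||b] := @integrable_small_value _ (measurableTypeR R) _ _ h `]-oo, - n%:R] n.+1%:R^-1 ih.
  - exact: measurable_itv.
  - by apply: etrans (lebesgue_measure_itv _) _; rewrite /= ltNyr.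
  - by rewrite invr_gt0.
  by rewrite /= in_itv/= => nb nh; exists b.
have [b /all_and2[nb hb0]] := choice hb.
have [a /all_and2[na ha0]] := choice ha.
have ab n : a n < b n.
  apply: le_lt_trans (na n) _; apply: lt_le_trans (nb n).
  by rewrite (@le_lt_trans _ _ 0)// ?oppr_le0// ltr_wpDl.
have ch : continuous h.
  by move=> x; apply: differentiable_continuous; apply/derivable1_diffP; case: (dh x).
have FTC n : (\int[lebesgue_measure]_(x in `[a n, b n]) (h' x)%:E = (h (b n) - h (a n))%:E)%E.
  rewrite EFinB; apply: continuous_FTC2 => //.
  - exact: continuous_subspaceT.
  - split.
    + by move=> x _; case: (dh x).
    + exact: cvg_at_right_filter (ch _).
    + exact: cvg_at_left_filter (ch _).
  - by move=> x _; rewrite derive1E; case: (dh x).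
have mh' := measurable_int _ ih'.
have [|||||] := @dominated_convergence _ (measurableTypeR R) _ (@lebesgue_measure R)
  setT measurableT
  (fun n => (EFin \o h') \_ `[a n, b n]) (EFin \o h') (abse \o (EFin \o h')).
- move=> n; apply: (@measurable_int _ _ _ (@lebesgue_measure R));
  apply: (integrable_mkcond _ _).1; first exact: measurable_itv.
  by apply: integrableS ih' => //; exact: measurable_itv.
- exact: mh'.
- apply: aeW => x _; apply: cvg_near_cst; near=> n.
  rewrite patchE mem_set//= in_itv/=; apply/andP; split.
    apply: (le_trans (na n)); rewrite lerNl.
    by apply: le_trans (ler_norm _) _; rewrite normrN; near: n; exact: nbhs_infty_ger.
  apply: le_trans (nb n); rewrite ler_wpDr//.
  by apply: le_trans (ler_norm _) _; near: n; exact: nbhs_infty_ger.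
- exact: integrable_abse.
- apply: aeW => x n _; rewrite patchE; case: ifPn => //= _.
  by rewrite lee_fin normr0.
move=> _ _ /cvg_lim <-//; apply/cvg_lim => //.
under eq_fun do rewrite -integral_mkcond FTC.
apply: cvg_EFin; first exact: nearW.
apply/cvgr0Pnorm_le => e e0; near=> n => /=.
apply: (le_trans (ler_normB _ _)); rewrite (splitr e).
have ne : n.+1%:R^-1 <= e / 2.
  near: n; have := near_infty_natSinv_lt (PosNum (divr_gt0 e0 (ltr0n _ 2))).
  by apply: filterS => n /= /ltW.
by apply: lerD; apply: le_trans ne.
Unshelve. all: by end_near. Qed.

(** As s varies, this is the line through x parallel to the i-th axis, written without a vector
    space structure on tuples. *)
Definition upd n (T : Type) (x : n.-tuple T) (i : 'I_n) (s : T) : n.-tuple T :=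
  [tuple if j == i then s else tnth x j | j < n].

Lemma upd_cons0 n (T : Type) (a : T) (y : n.-tuple T) s :
  upd [tuple of a :: y] ord0 s = [tuple of s :: y].
Proof.
apply/eq_from_tnth => j; rewrite tnth_mktuple.
by case: (fintype.unliftP ord0 j) => [k ->|->//]; rewrite !tnthS.
Qed.

Lemma upd_consS n (T : Type) (a : T) (y : n.-tuple T) i s :
  upd [tuple of a :: y] (lift ord0 i) s = [tuple of a :: upd y i s].
Proof.
apply/eq_from_tnth => j; rewrite tnth_mktuple.
case: (fintype.unliftP ord0 j) => [k ->|->//].
by rewrite (inj_eq lift_inj) !tnthS tnth_mktuple.
Qed.

(** * Measurability and integration on R x R^n *)

Section real_tuples.
Context {R : realType}.
Local Notation tup n := (n.-tuple (measurableTypeR R)).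

(* h is the pointwise limit of the functions obtained by rounding the first
   coordinate down to a multiple of 1/(k+1). *)
Lemma measurable_of_slices n (h : tup n.+1 -> R) :
  (forall a : R, measurable_fun setT (fun y : tup n => h [tuple of a :: y])) ->
  (forall y : tup n, continuous (fun s : R => h [tuple of s :: y])) ->
  measurable_fun setT h.
Proof.
move=> mh ch.
pose q k (s : R) : R := (Num.floor (k.+1%:R * s))%:~R / k.+1%:R.
apply: (@measurable_fun_cvg _ (tup n.+1) _ _
  (fun k x => h [tuple of q k (thead x) :: [tuple of behead x]])).
- move=> k _ A mA; rewrite setTI.
  (* On the slab where the first coordinate is rounded to z / (k + 1), the approximation depends on
     the remaining coordinates only; there are countably many slabs. *)
  rewrite (_ : _ @^-1` _ = \bigcup_(z : int)
     ((fun x : tup n.+1 => thead x) @^-1` `[z%:~R / k.+1%:R, (z + 1)%:~R / k.+1%:R[%classic `&`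
      (fun x : tup n.+1 => [tuple of behead x]) @^-1`
         ((fun y : tup n => h [tuple of (z%:~R / k.+1%:R : R) :: y]) @^-1` A))).
    apply: countable_bigcupT_measurable => // z; apply: measurableI.
      rewrite -[X in measurable X]setTI; apply: (measurable_tnth (T := measurableTypeR R)) => //.
    rewrite -[X in measurable X]setTI; apply: (measurable_behead (T := measurableTypeR R)) => //.
    by rewrite -[X in measurable X]setTI; exact: mh.
  apply/seteqP; split => x.
    move=> Ax; exists (Num.floor (k.+1%:R * thead x)) => //; split => //=.
    rewrite in_itv/= ler_pdivrMr// ltr_pdivlMr// mulrC.
    by rewrite [_ * k.+1%:R]mulrC floor_itv.
  move=> [z _ [/=]]; rewrite in_itv/= ler_pdivrMr// ltr_pdivlMr// => zx.
  by rewrite /q (@floor_def _ _ z)// mulrC.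
- move=> x _; have -> : h x = h [tuple of thead x :: [tuple of behead x]].
    by rewrite -tuple_eta.
  suff qx : q k (thead x) @[k --> \oo] --> (thead x : R) by exact: (cvg_comp _ _ qx (ch _ _)).
  apply/cvgrPdist_le => e e0; near=> k.
  have /andP[lx xl] := floor_itv (k.+1%:R * thead x).
  have k0 : 0 < k.+1%:R :> R by [].
  have -> : thead x - q k (thead x) =
    (k.+1%:R * thead x - (Num.floor (k.+1%:R * thead x))%:~R) / k.+1%:R.
    by rewrite /q; field; rewrite gt_eqF.
  rewrite ger0_norm; last by rewrite divr_ge0// subr_ge0.
  apply: (@le_trans _ _ k.+1%:R^-1).
    rewrite ler_pdivrMr// mulVf ?gt_eqF// lerBlDl; apply/ltW.
    by apply: lt_le_trans xl _; rewrite intrD.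
  near: k; have := near_infty_natSinv_lt (PosNum e0).
  by apply: filterS => k /= /ltW.
Unshelve. all: by end_near. Qed.

(** Induction on n: the slices with fixed first coordinate are again separately continuous, hence
    measurable, and continuity in the first coordinate glues them. This yields measurability for the
    product sigma-algebra directly, with no comparison with the topology of R^n. *)
Lemma measurable_separately_continuous n (h : tup n -> R) :
  (forall x i, continuous (fun s : R => h (upd x i s))) ->
  measurable_fun setT h.
Proof.
elim: n h => [|n IH] h ch.
  have -> : h = cst (h [tuple]) by apply/funext => x; rewrite [x]tuple0.
  exact: measurable_cst.
apply: measurable_of_slices => [a|y].
  apply: IH => y i s.
  have -> : (fun s => h [tuple of a :: upd y i s]) =
    (fun s => h (upd [tuple of a :: y] (lift ord0 i) s)).
    by apply/funext => u; rewrite upd_consS.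
  exact: ch.
move=> s; have -> : (fun s => h [tuple of s :: y]) =
    (fun s => h (upd [tuple of 0 :: y] ord0 s)).
  by apply/funext => u; rewrite upd_cons0.
exact: ch.
Qed.

Lemma integrable_cons n (h : tup n.+1 -> R) :
  (@lebesgue_Rn R n.+1).-integrable setT (EFin \o h) ->
  (lebesgue_measure \x @lebesgue_Rn R n)%E.-integrable setT
    (EFin \o h \o @cons_pair R n).
Proof.
move=> ih0; have /integrableP[mh ih] := ih0; apply/integrableP; split.
  by apply: measurableT_comp mh _; exact: measurable_cons_pair.
move: ih; rewrite /= ge0_integral_pushforward//=.
  exact: measurable_cons_pair.
exact: (measurable_int _ (integrable_abse ih0)).
Qed.

Lemma integral_cons n (h : tup n.+1 -> R) :
  (@lebesgue_Rn R n.+1).-integrable setT (EFin \o h) ->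
  (\int[@lebesgue_Rn R n.+1]_x (h x)%:E =
   \int[lebesgue_measure \x @lebesgue_Rn R n]_p (h (cons_pair p))%:E)%E.
Proof.
move=> ih.
have := @integral_pushforward _ _ _ _ _ (@cons_pair R n) (@measurable_cons_pair R n)
  (lebesgue_measure \x @lebesgue_Rn R n)%E setT (EFin \o h) (measurable_int _ ih).
rewrite preimage_setT => /(_ (integrable_cons ih) measurableT).
exact.
Qed.

End real_tuples.

Section divergence_theorem.
Context {R : realType}.
Local Notation tup n := (n.-tuple (measurableTypeR R)).

(** Induction on n through Fubini. If i is the first coordinate, it is integrated first and the
    one-dimensional case applies on each line; otherwise it is integrated last and the induction
    hypothesis applies on each slice. Slices of an integrable function are integrable only almost
    everywhere, so integrability of the slice is a premise of [IHa]. *)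
Lemma integral_partial_eq0 n (i : 'I_n) (h h' : tup n -> R) :
  (forall x (s : R), is_derive s 1 (fun s : R => h (upd x i s)) (h' (upd x i s))) ->
  (forall x, continuous (fun s : R => h' (upd x i s))) ->
  (@lebesgue_Rn R n).-integrable setT (EFin \o h) ->
  (@lebesgue_Rn R n).-integrable setT (EFin \o h') ->
  (\int[@lebesgue_Rn R n]_x (h' x)%:E = 0)%E.
Proof.
elim: n i h h' => [[]//|n IH] i h h' dh ch ih ih'.
have jh := integrable_cons ih; have jh' := integrable_cons ih'.
rewrite integral_cons//.
case: (fintype.unliftP ord0 i) => [k ik|i0].
- have IHa (a : R) :
    (@lebesgue_Rn R n).-integrable setT (fun y => (h [tuple of a :: y])%:E) ->
    (@lebesgue_Rn R n).-integrable setT (fun y => (h' [tuple of a :: y])%:E) ->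
    (\int[@lebesgue_Rn R n]_y (h' [tuple of a :: y])%:E = 0)%E.
    move=> ia ia';
    apply: (IH k (fun y => h [tuple of a :: y]) (fun y => h' [tuple of a :: y])) => //.
    + move=> y s; have := dh [tuple of a :: y] s; rewrite ik upd_consS.
      by under eq_fun do rewrite upd_consS.
    + move=> y s; have := ch [tuple of a :: y] s; rewrite ik.
      by under eq_fun do rewrite upd_consS.
  rewrite -(integral12_prod_meas1 jh').
  rewrite -[RHS](@integral0 _ _ _ (@lebesgue_measure R) setT).
  apply: ae_eq_integral => //.
    exact: measurable_fubini_F jh'.
  have := ae_integrable1 jh; have := ae_integrable1 jh'.
  apply: filterS2 => a ia' ia _; exact: IHa.
- have IHa (y : tup n) :
    (@lebesgue_measure R).-integrable setT (fun a : R => (h [tuple of a :: y])%:E) ->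
    (@lebesgue_measure R).-integrable setT (fun a : R => (h' [tuple of a :: y])%:E) ->
    (\int[@lebesgue_measure R]_a (h' [tuple of a :: y])%:E = 0)%E.
    move=> ia ia';
    apply: (@integral_derivative_eq0 _ (fun a => h [tuple of a :: y])
      (fun a => h' [tuple of a :: y])) => //.
    + move=> s; have := dh [tuple of 0 :: y] s; rewrite i0 upd_cons0.
      by under eq_fun do rewrite upd_cons0.
    + move=> s; have := ch [tuple of 0 :: y] s; rewrite i0.
      by under eq_fun do rewrite upd_cons0.
  rewrite -(integral21_prod_meas1 jh').
  rewrite -[RHS](@integral0 _ _ _ (@lebesgue_Rn R n) setT).
  apply: ae_eq_integral => //.
    exact: measurable_fubini_G jh'.
  have := ae_integrable2 jh; have := ae_integrable2 jh'.
  apply: filterS2 => a ia' ia _; exact: IHa.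
Qed.

End divergence_theorem.

(** * Directional derivatives as derivatives along lines *)

Section lines.
Context {R : realType}.

(** The two difference quotients agree term by term. The offset c serves [rowt_upd], where the line
    passes through x at the parameter [tnth x i]. *)
Lemma is_derive_line (V W : normedModType R) (g : V -> W) (z v : V) (dg : W) (c s : R) :
  is_derive ((s - c) *: v + z) v g dg ->
  is_derive s 1 (fun s : R => g ((s - c) *: v + z)) dg.
Proof.
have E : (fun h : R => h^-1 *: (((fun s : R => g ((s - c) *: v + z)) \o shift s) (h *: 1) -
    g ((s - c) *: v + z))) =
  (fun h : R => h^-1 *: ((g \o shift ((s - c) *: v + z)) (h *: v) - g ((s - c) *: v + z))).
  apply/funext => h /=; congr (_ *: (g _ - _)).
  by rewrite -[h *: 1]/(h * 1) mulr1 -addrA scalerDl addrA.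
case=> dv <-; apply: DeriveDef; last by rewrite /derive E.
by rewrite /derivable E.
Qed.

Lemma is_derive_line0 (V W : normedModType R) (g : V -> W) (z v : V) (dg : W) :
  is_derive (0 : R) 1 (fun s : R => g (s *: v + z)) dg -> is_derive z v g dg.
Proof.
have E : (fun h : R => h^-1 *: (((fun s : R => g (s *: v + z)) \o shift 0) (h *: 1) -
    g (0 *: v + z))) =
  (fun h : R => h^-1 *: ((g \o shift z) (h *: v) - g z)).
  apply/funext => h /=; congr (_ *: (g _ - g _)); last by rewrite scale0r add0r.
  by rewrite -[h *: 1]/(h * 1) mulr1 addr0.
case=> dv <-; apply: DeriveDef; last by rewrite /derive -E.
by rewrite /derivable -E.
Qed.

Context {d : nat}.
Local Notation point := (R * 'rV[R]_d)%type.
Local Notation tup := (d.-tuple (measurableTypeR R)).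

Lemma rowt_upd (x : tup) (i : 'I_d) (s : R) :
  rowt (upd x i s) = (s - tnth x i) *: delta_mx 0 i + rowt x.
Proof.
apply/rowP => j; rewrite !mxE tnth_mktuple eqxx/=.
by case: eqP => [->|_]; rewrite ?mulr1 ?subrK// mulr0 add0r.
Qed.

Lemma is_derive_space (g : point -> R) (t : R) (x : tup) (i : 'I_d) (s dg : R) :
  is_derive (t, rowt (upd x i s)) (@dir R d (Some i)) g dg ->
  is_derive s 1 (fun s : R => g (t, rowt (upd x i s))) dg.
Proof.
have E u : (t, rowt (upd x i u)) = (u - tnth x i) *: @dir R d (Some i) + (t, rowt x).
  by rewrite -[RHS]/(_ *: 0 + t, _ *: delta_mx 0 i + _) scaler0 add0r rowt_upd.
by rewrite E => /is_derive_line; under [in X in _ -> X]eq_fun do rewrite E.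
Qed.

Lemma is_derive_time (g : point -> R) (t : R) (x : 'rV[R]_d) (dg : R) :
  is_derive (t, x) (@dir R d None) g dg -> is_derive t 1 (fun t : R => g (t, x)) dg.
Proof.
have E u : (u, x) = (u - 0) *: @dir R d None + (0, x).
  by rewrite subr0 -[RHS]/(u * 1 + 0, u *: 0 + x) scaler0 add0r mulr1 addr0.
by rewrite E => /is_derive_line; under [in X in _ -> X]eq_fun do rewrite E.
Qed.

Lemma continuous_rowt_upd (x : tup) (i : 'I_d) :
  continuous (fun s : R => rowt (upd x i s) : 'rV[R]_d).
Proof.
move=> s; under eq_fun do rewrite rowt_upd.
by apply: cvgD; [apply: cvgZr_tmp; apply: cvgB => //; exact: cvg_cst|exact: cvg_cst].
Qed.

Lemma continuous_slice (q : point -> R) (t s : R) (x : tup) (i : 'I_d) :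
  {for (t, rowt (upd x i s)), continuous q} ->
  {for s, continuous (fun s : R => q (t, rowt (upd x i s)))}.
Proof.
move=> cq; have cs : (t, rowt (upd x i u)) @[u --> s] --> (t, rowt (upd x i s)).
  have c1 : cst t u @[u --> s] --> t by exact: cvg_cst.
  exact: (cvg_pair c1 (@continuous_rowt_upd x i s)).
exact: (cvg_comp _ _ cs cq).
Qed.

End lines.

(** * Balance laws on a slab ]t0, t1[ x R^d *)

Section slab.
Context {R : realType} {d : nat}.
Local Notation point := (R * 'rV[R]_d)%type.
Local Notation tup := (d.-tuple (measurableTypeR R)).
Local Notation mu := (@lebesgue_Rn R d).
Implicit Types (q s J : point -> R) (w g : 'rV[R]_d -> R).

Definition slab_continuous (t0 t1 : R) q :=
  forall t x, t0 < t < t1 -> {for (t, x), continuous q}.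

Definition slab_derive (t0 t1 : R) (a : option 'I_d) q q' :=
  forall t x, t0 < t < t1 -> is_derive (t, x) (dir a) q (q' (t, x)).

(** The constant C is uniform in t, so that a bound on a time derivative is a majorant independent
    of time, as differentiation under the integral requires. *)
Definition slab_bounded (t0 t1 : R) w g (m n e : nat) q :=
  exists2 C : R, 0 <= C & forall t x, t0 < t < t1 ->
    `|q (t, x)| <= C * ((1 + `|x|) ^+ m * w x ^+ n * g x ^+ e).

(* q' is the partial derivative of q in direction a, and both are continuous and
   O((1 + |x|)^m w^n g^e).  Products add the exponents, so that checking
   integrability, i.e. (m, n, e) <= (2, 3, 1), is bookkeeping. *)
Definition tame (t0 t1 : R) w g a m n e q q' :=
  [/\ slab_continuous t0 t1 q, slab_continuous t0 t1 q', slab_derive t0 t1 a q q',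
      slab_bounded t0 t1 w g m n e q & slab_bounded t0 t1 w g m n e q'].

Lemma measurable_slab t0 t1 q t : t0 < t < t1 -> slab_continuous t0 t1 q ->
  measurable_fun setT (fun x : tup => q (t, rowt x)).
Proof.
move=> tI cq; apply: measurable_separately_continuous => x i s.
exact/continuous_slice/cq.
Qed.

Variables (t0 t1 : R) (w g : 'rV[R]_d -> R).
Hypothesis (w_ge1 : forall x, 1 <= w x) (g_ge0 : forall x, 0 <= g x).
Hypothesis integrable_weight : mu.-integrable setT
  (fun x => ((1 + `|rowt x|) ^+ 2 * w (rowt x) ^+ 3 * g (rowt x))%:E).

Local Notation bounded := (slab_bounded t0 t1 w g).
Local Notation cont := (slab_continuous t0 t1).

Lemma weight_ge0 m n e x : 0 <= (1 + `|x|) ^+ m * w x ^+ n * g x ^+ e.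
Proof.
by rewrite !mulr_ge0// exprn_ge0// ?addr_ge0// (le_trans _ (w_ge1 x)).
Qed.

Lemma integrable_slab q t : t0 < t < t1 -> cont q -> bounded 2 3 1 q ->
  mu.-integrable setT (EFin \o (fun x : tup => q (t, rowt x))).
Proof.
move=> tI cq [C C0 qC].
apply: (@le_integrable _ _ _ mu setT measurableT _
  (fun x => (C * ((1 + `|rowt x|) ^+ 2 * w (rowt x) ^+ 3 * g (rowt x)))%:E)).
- by apply/measurable_EFinP; exact: measurable_slab cq.
- move=> x _; rewrite lee_fin (le_trans (qC _ _ tI))// expr1.
  exact: ler_norm.
- under eq_fun do rewrite EFinM.
  exact: integrableZl.
Qed.

Lemma int_RnB q1 q2 t :
  mu.-integrable setT (EFin \o (fun x : tup => q1 (t, rowt x))) ->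
  mu.-integrable setT (EFin \o (fun x : tup => q2 (t, rowt x))) ->
  int_Rn (fun x => q1 (t, x) - q2 (t, x)) =
  int_Rn (fun x => q1 (t, x)) - int_Rn (fun x => q2 (t, x)).
Proof. by move=> i1 i2; rewrite /int_Rn RintegralB. Qed.

Lemma int_Rn_partial_eq0 (i : 'I_d) J J' t : t0 < t < t1 ->
  tame t0 t1 w g (Some i) 2 3 1 J J' -> int_Rn (fun x => J' (t, x)) = 0.
Proof.
move=> tI [cJ cJ' dJ bJ bJ']; rewrite /int_Rn /Rintegral.
suff -> : (\int[mu]_x (J' (t, rowt x))%:E = 0)%E by [].
apply: (@integral_partial_eq0 R d i (fun x => J (t, rowt x))).
- by move=> x s; apply: is_derive_space; exact: dJ.
- by move=> x s; exact/continuous_slice/cJ'.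
- exact: integrable_slab.
- exact: integrable_slab.
Qed.

Lemma derive_int_Rn q q' t : t0 < t < t1 -> tame t0 t1 w g None 2 3 1 q q' ->
  is_derive t 1 (fun t => int_Rn (fun x => q (t, x))) (int_Rn (fun x => q' (t, x))).
Proof.
move=> tI [cq cq' dq bq [C C0 q'C]].
have dq1 u x : t0 < u < t1 -> is_derive u 1 (fun t => q (t, rowt x)) (q' (u, rowt x)).
  by move=> uI; apply: is_derive_time; exact: dq.
have E u x : t0 < u < t1 ->
    partial1of2 (fun t (x : tup) => q (t, rowt x)) u x = q' (u, rowt x).
  by move=> uI; rewrite partial1of2E; have [_ ->] := dq1 u x uI.
pose G (x : tup) := C * ((1 + `|rowt x|) ^+ 2 * w (rowt x) ^+ 3 * g (rowt x) ^+ 1).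
have tI' : `]t0, t1[%classic t by rewrite /= in_itv.
have Iq u : `]t0, t1[%classic u -> mu.-integrable setT (EFin \o (fun x : tup => q (u, rowt x))).
  by rewrite /= in_itv/= => uI; exact: integrable_slab.
have Dq u (x : tup) : `]t0, t1[%classic u -> setT x -> derivable (fun t => q (t, rowt x)) u 1.
  by rewrite /= in_itv/= => uI _; have [] := dq1 u x uI.
have G0 x : 0 <= G x by rewrite mulr_ge0// weight_ge0.
have IG : mu.-integrable setT (EFin \o G).
  by rewrite /comp/G; under eq_fun do rewrite expr1 EFinM; exact: integrableZl.
have ubG u (x : tup) : `]t0, t1[%classic u -> setT x ->
    `|partial1of2 (fun t (x : tup) => q (t, rowt x)) u x| <= G x.
  by rewrite /= in_itv/= => uI _; rewrite E// q'C.
have der := @derivable_under_integral _ _ _ mu _ _ measurableT _ _ _ tI' Iq Dq _ G0 IG ubG.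
have eqd := @differentiation_under_integral _ _ _ mu _ _ measurableT _ _ _ tI' Iq Dq _ G0 IG ubG.
apply: DeriveDef; first exact: der.
rewrite -derive1E [LHS]eqd; apply: eq_Rintegral => x _; exact: E.
Qed.

(** Integrability of the source is part of the conclusion: s is the difference of q' and the
    divergence of the flux, both integrable. The virial law relies on it to split its source. *)
Lemma balance_law q q' s (J J' : 'I_d -> point -> R) t : t0 < t < t1 ->
  tame t0 t1 w g None 2 3 1 q q' ->
  (forall i, tame t0 t1 w g (Some i) 2 3 1 (J i) (J' i)) ->
  (forall x, q' (t, x) = s (t, x) + \sum_i J' i (t, x)) ->
  mu.-integrable setT (EFin \o (fun x : tup => s (t, rowt x))) /\
  is_derive t 1 (fun t => int_Rn (fun x => q (t, x))) (int_Rn (fun x => s (t, x))).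
Proof.
move=> tI tq tJ q'E.
(* Integrability travels with the vanishing integral through the sum, since adding two integrals
   requires it. *)
pose P (h : point -> R) := mu.-integrable setT (EFin \o (fun x : tup => h (t, rowt x))) /\
  int_Rn (fun x => h (t, x)) = 0.
have [IJ J0] : P (fun z => \sum_i J' i z).
  rewrite (_ : (fun z => _) = \sum_i J' i); last by apply/funext => z; rewrite fct_sumE.
  apply: (big_ind P).
  - split; first exact: integrable0.
    by rewrite /int_Rn Rintegral_cst// mul0r.
  - move=> h1 h2 [i1 e1] [i2 e2]; split.
      have -> : (EFin \o (fun x : tup => (h1 + h2) (t, rowt x))) =
        ((EFin \o (fun x : tup => h1 (t, rowt x))) \+ (EFin \o (fun x : tup => h2 (t, rowt x))))%E.
        by apply/funext => x /=; rewrite EFinD.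
      exact: integrableD.
    by rewrite /int_Rn RintegralD// -/(int_Rn (fun x => h1 (t, x)))
      -/(int_Rn (fun x => h2 (t, x))) e1 e2 addr0.
  - move=> i _; have [cJ cJ' _ _ bJ'] := tJ i; split; first exact: integrable_slab.
    exact: int_Rn_partial_eq0 (tJ i).
have [cq cq' _ _ bq'] := tq.
have Iq' := integrable_slab tI cq' bq'.
have sE x : s (t, x) = q' (t, x) - \sum_i J' i (t, x) by rewrite q'E addrK.
split.
  have -> : (EFin \o (fun x : tup => s (t, rowt x))) =
    ((EFin \o (fun x : tup => q' (t, rowt x))) \-
     (EFin \o (fun x : tup => (\sum_i J' i (t, rowt x))%R)))%E.
    by apply/funext => x /=; rewrite sE EFinB.
  exact: integrableB.
have -> : int_Rn (fun x => s (t, x)) = int_Rn (fun x => q' (t, x)).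
  rewrite (_ : (fun x => s (t, x)) = fun x => q' (t, x) - \sum_i J' i (t, x)); last exact/funext.
  by rewrite (int_RnB (q2 := fun z => \sum_i J' i z))// J0 subr0.
exact: derive_int_Rn.
Qed.

End slab.

(** * Calculus of tame functions *)

Section tame_algebra.
Context {R : realType} {d : nat}.
Local Notation point := (R * 'rV[R]_d)%type.
Variables (t0 t1 : R) (w g : 'rV[R]_d -> R).
Hypothesis (w_ge1 : forall x, 1 <= w x) (g_ge0 : forall x, 0 <= g x).
Local Notation bounded := (slab_bounded t0 t1 w g).
Local Notation cont := (slab_continuous t0 t1).
Local Notation tame := (tame t0 t1 w g).
Implicit Types (q : point -> R).

(** The bases 1 + |x| and w are at least 1, so their exponents may be raised; g is only nonnegative,
    so e stays fixed. *)
Lemma slab_bounded_weaken m n e m' n' q : (m <= m')%N -> (n <= n')%N ->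
  bounded m n e q -> bounded m' n' e q.
Proof.
move=> mm nn [C C0 qC]; exists C => // t x tI; apply: le_trans (qC _ _ tI) _.
have w0 := le_trans ler01 (w_ge1 x).
apply: ler_wpM2l => //; apply: ler_pM; rewrite ?mulr_ge0 ?exprn_ge0 ?addr_ge0//.
apply: ler_pM; rewrite ?exprn_ge0 ?addr_ge0//; apply: ler_weXn2l => //.
by rewrite lerDl.
Qed.

Lemma slab_boundedD m n e q1 q2 : bounded m n e q1 -> bounded m n e q2 ->
  bounded m n e (fun z => q1 z + q2 z).
Proof.
move=> [C C0 qC] [D D0 qD]; exists (C + D); first exact: addr_ge0.
move=> t x tI; rewrite mulrDl (le_trans (ler_normD _ _))// lerD//.
- exact: qC.
- exact: qD.
Qed.

Lemma slab_boundedM m n e m' n' e' q1 q2 : bounded m n e q1 -> bounded m' n' e' q2 ->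
  bounded (m + m') (n + n') (e + e') (fun z => q1 z * q2 z).
Proof.
move=> [C C0 qC] [D D0 qD]; exists (C * D); first exact: mulr_ge0.
move=> t x tI; rewrite normrM.
apply: le_trans (ler_pM _ _ (qC _ _ tI) (qD _ _ tI)) _ => //.
by rewrite le_eqVlt; apply/orP; left; apply/eqP; rewrite !exprD; ring.
Qed.

Lemma slab_boundedN m n e q : bounded m n e q -> bounded m n e (fun z => - q z).
Proof. by move=> [C C0 qC]; exists C => // t x tI; rewrite normrN; exact: qC. Qed.

Lemma slab_bounded_cst (c : R) : bounded 0 0 0 (fun=> c).
Proof. by exists `|c| => // t x tI; rewrite !expr0 !mulr1. Qed.

Lemma slab_bounded_le m n e q1 q2 (C : R) : 0 <= C ->
  (forall t x, t0 < t < t1 -> `|q1 (t, x)| <= C * `|q2 (t, x)|) ->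
  bounded m n e q2 -> bounded m n e q1.
Proof.
move=> C0 qC [D D0 qD]; exists (C * D); first exact: mulr_ge0.
by move=> t x tI; rewrite -mulrA (le_trans (qC _ _ tI))// ler_wpM2l// qD.
Qed.

Lemma tame_weaken a m n e m' n' q q' : (m <= m')%N -> (n <= n')%N ->
  tame a m n e q q' -> tame a m' n' e q q'.
Proof.
by move=> mm nn [c c' dq b b']; split => //; exact: (slab_bounded_weaken mm nn).
Qed.

Lemma tameD a m n e q1 q1' q2 q2' : tame a m n e q1 q1' -> tame a m n e q2 q2' ->
  tame a m n e (fun z => q1 z + q2 z) (fun z => q1' z + q2' z).
Proof.
move=> [c1 c1' d1 b1 b1'] [c2 c2' d2 b2 b2']; split; try exact: slab_boundedD.
- by move=> t x tI; apply: cvgD; [exact: c1|exact: c2].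
- by move=> t x tI; apply: cvgD; [exact: c1'|exact: c2'].
- by move=> t x tI; have := d1 t x tI; have := d2 t x tI; move=> ? ?; exact: is_deriveD.
Qed.

Lemma tameN a m n e q q' : tame a m n e q q' ->
  tame a m n e (fun z => - q z) (fun z => - q' z).
Proof.
move=> [c c' dq b b']; split; try exact: slab_boundedN.
- by move=> t x tI; apply: cvgN; exact: c.
- by move=> t x tI; apply: cvgN; exact: c'.
- by move=> t x tI; have ? := dq t x tI; exact: is_deriveN.
Qed.

Lemma tameB a m n e q1 q1' q2 q2' : tame a m n e q1 q1' -> tame a m n e q2 q2' ->
  tame a m n e (fun z => q1 z - q2 z) (fun z => q1' z - q2' z).
Proof. by move=> t12 /tameN; exact: tameD. Qed.

Lemma tameM a m n e m' n' e' q1 q1' q2 q2' :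
  tame a m n e q1 q1' -> tame a m' n' e' q2 q2' ->
  tame a (m + m') (n + n') (e + e') (fun z => q1 z * q2 z)
    (fun z => q1' z * q2 z + q1 z * q2' z).
Proof.
move=> [c1 c1' d1 b1 b1'] [c2 c2' d2 b2 b2']; split.
- by move=> t x tI; apply: cvgM; [exact: c1|exact: c2].
- move=> t x tI; apply: cvgD; apply: cvgM.
  + exact: c1'.
  + exact: c2.
  + exact: c1.
  + exact: c2'.
- move=> t x tI; have ? := d1 t x tI; have ? := d2 t x tI.
  apply: (is_derive_eq (is_deriveM _ _)); rewrite -![_ *: _]/(_ * _).
  by rewrite addrC [q2 _ * _]mulrC.
- exact: slab_boundedM.
- by apply: slab_boundedD; exact: slab_boundedM.
Qed.

Lemma tame_cst a (c : R) : tame a 0 0 0 (fun=> c) (fun=> 0).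
Proof.
split; try exact: slab_bounded_cst.
- by move=> t x tI; exact: cvg_cst.
- by move=> t x tI; exact: cvg_cst.
- by move=> t x tI; exact: is_derive_cst.
Qed.

Lemma tameZ a m n e (c : R) q q' : tame a m n e q q' ->
  tame a m n e (fun z => c * q z) (fun z => c * q' z).
Proof.
have E : (fun z => 0 * q z + c * q' z) = (fun z => c * q' z).
  by apply/funext => z; rewrite mul0r add0r.
by move=> tq; have := tameM (tame_cst a c) tq; rewrite !add0n E.
Qed.

Lemma tame_sum a m n e I (r : seq I) (q q' : I -> point -> R) :
  (forall i, tame a m n e (q i) (q' i)) ->
  tame a m n e (fun z => \sum_(i <- r) q i z) (fun z => \sum_(i <- r) q' i z).
Proof.
move=> tq; elim: r => [|i r IH].
  have E (h : I -> point -> R) :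
      (fun z : point => \sum_(i <- [::]) h i z) = (fun=> 0) :> (point -> R).
    by apply/funext => z; rewrite big_nil.
  rewrite !E; have [H1 H2 H3 H4 H5] := tame_cst a 0; split => //.
  - by exists 0 => // t x _; rewrite normr0 mul0r.
  - by exists 0 => // t x _; rewrite normr0 mul0r.
have E (h : I -> point -> R) : (fun z : point => \sum_(i <- i :: r) h i z) =
    (fun z => h i z + \sum_(i <- r) h i z) :> (point -> R).
  by apply/funext => z; rewrite big_cons.
rewrite !E; exact: tameD.
Qed.

(** The Boolean is a Kronecker delta: along x_k it tests k = i, along t it is false. The sup norm
    dominates each coordinate, so a factor x_i costs one power of 1 + |x|. *)
Lemma tame_coord a (i : 'I_d) :
  tame a 1 0 0 (fun z => z.2 0 i) (fun=> (a == Some i)%:R).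
Proof.
split.
- move=> t x tI; apply: (@continuous_comp _ _ _ (fun z : point => z.2) (fun x : 'rV[R]_d => x 0 i)).
    exact: cvg_snd.
  exact: coord_continuous.
- by move=> t x tI; exact: cvg_cst.
- move=> t x tI; apply: is_derive_line0.
  have -> : (fun s : R => ((s *: dir a + (t, x)).2 : 'rV_d) 0 i) =
     (fun s : R => (a == Some i)%:R * s + x 0 i).
    apply/funext => s; rewrite -[(s *: _ + _).2]/(s *: (dir a).2 + x) !mxE mulrC.
    case: a => [j|] /=; last by rewrite mxE mul0r.
    by rewrite !mxE eqxx/= eq_sym (inj_eq Some_inj).
  apply: is_derive_eq.
  by rewrite addr0 -[_ *: _]/(_ * _) mulr1.
- exists 1 => // t x tI; rewrite !expr0 !mulr1 mul1r expr1.
  apply: (@le_trans _ _ `|x|); last by rewrite lerDr.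
  by rewrite [leRHS]/Num.Def.normr/= mx_normrE; exact: (le_bigmax _ _ (0, i)).
- exists 1 => // t x tI; rewrite !expr0 !mulr1 mul1r expr1.
  by apply: (@le_trans _ _ 1); [case: eqP => _; rewrite ?normr1 ?normr0|rewrite lerDl].
Qed.

End tame_algebra.

(** * Mixed derivatives, bounds and pointwise identities *)

Section mixed_derivatives.
Context {R : realType} {V : normedModType R}.
Implicit Types (g gu gv guv gvu : V -> R) (u v z : V).

Lemma is_derive_line_at (W : normedModType R) (g : V -> W) (v z : V) (s : R) (dg : W) :
  is_derive (s *: v + z) v g dg ->
  is_derive s 1 (fun s : R => g (s *: v + z)) dg.
Proof.
rewrite -[s in X in X -> _]subr0 => /is_derive_line.
by under eq_fun do rewrite subr0.
Qed.

Lemma MVT_line g g' v z (h : R) : 0 < h ->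
  (forall s : R, 0 <= s <= h -> is_derive (s *: v + z) v g (g' (s *: v + z))) ->
  exists2 s : R, 0 <= s <= h & g (h *: v + z) - g z = h * g' (s *: v + z).
Proof.
move=> h0 dg.
have dl (s : R) : s \in `[0, h] ->
    is_derive s 1 (fun s : R => g (s *: v + z)) (g' (s *: v + z)).
  by rewrite in_itv/= => sh; apply: is_derive_line_at; exact: dg.
have cl : {within `[0, h], continuous (fun s : R => g (s *: v + z))}.
  by apply: derivable_within_continuous => s /dl[].
have dl' (s : R) : s \in `]0, h[ ->
    is_derive s 1 (fun s : R => g (s *: v + z)) (g' (s *: v + z)).
  by move=> sh; apply: dl; exact: subset_itv_oo_cc sh.
have [s sh E] := @MVT_segment R _ _ 0 h (ltW h0) dl' cl.
exists s; first by rewrite in_itv in sh.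
by move: E; rewrite scale0r add0r subr0 mulrC.
Qed.

(** Two mean value theorems: along u for the increment y |-> g (h v + y) - g y, then along v for
    [gu]. *)
Lemma mixed_difference g gu guv u v z (h : R) : 0 < h ->
  (forall s r : R, 0 <= s <= h -> 0 <= r <= h ->
    is_derive (s *: u + (r *: v + z)) u g (gu (s *: u + (r *: v + z))) /\
    is_derive (s *: u + (r *: v + z)) v gu (guv (s *: u + (r *: v + z)))) ->
  exists s r : R, [/\ 0 <= s <= h, 0 <= r <= h &
    g (h *: u + (h *: v + z)) - g (h *: u + z) - (g (h *: v + z) - g z) =
    h * (h * guv (s *: u + (r *: v + z)))].
Proof.
move=> h0 dg; have hh : 0 <= h <= h by rewrite lexx ltW.
have h00 : 0 <= (0 : R) <= h by rewrite lexx ltW.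
have cmm (s r : R) : r *: v + (s *: u + z) = s *: u + (r *: v + z).
  exact: addrCA.
pose G y := g (h *: v + y) - g y.
have dG (s : R) : 0 <= s <= h -> is_derive (s *: u + z) u G
    (gu (h *: v + (s *: u + z)) - gu (s *: u + z)).
  move=> sh; apply: is_deriveB; last first.
    by have [+ _] := dg s 0 sh h00; rewrite scale0r add0r.
  apply: is_derive_line0.
  have -> : (fun r : R => g (h *: v + (r *: u + (s *: u + z)))) =
      (fun r : R => g (r *: u + (h *: v + (s *: u + z)))).
    by apply/funext => y; rewrite addrCA.
  apply: is_derive_line_at; rewrite scale0r add0r cmm.
  by have [] := dg s h sh hh.
have [s sh E] := MVT_line (g' := fun y => gu (h *: v + y) - gu y) h0 dG.
have dDg (r : R) : 0 <= r <= h -> is_derive (r *: v + (s *: u + z)) v gu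
    (guv (r *: v + (s *: u + z))).
  by move=> rh; have [_] := dg s r sh rh; rewrite cmm.
have [r rh E'] := MVT_line h0 dDg.
exists s, r; split => //.
by move: E; rewrite E' /G !cmm.
Qed.

Lemma near_parallelogram u v z (P : set V) : (\forall y \near z, P y) ->
  exists2 h : R, 0 < h & forall s r : R, 0 <= s <= h -> 0 <= r <= h ->
    P (s *: u + (r *: v + z)).
Proof.
move=> nP.
have c : (p.1 *: u + (p.2 *: v + z)) @[p --> ((0, 0) : R * R)] --> z.
  rewrite -[X in _ --> X]add0r -[X in _ --> _ + X]add0r -[X in _ --> X + _](scale0r u).
  rewrite -[X in _ --> _ + (X + _)](scale0r v).
  apply: cvgD; first by apply: cvgZr_tmp; exact: cvg_fst.
  by apply: cvgD; [apply: cvgZr_tmp; exact: cvg_snd|exact: cvg_cst].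
have /nbhs_ballP[e/= e0 eP] := c _ nP.
exists (e / 2); first exact: divr_gt0.
have le (s : R) : 0 <= s <= e / 2 -> `|0 - s| < e.
  move=> /andP[s0 se]; rewrite sub0r normrN ger0_norm// (le_lt_trans se)//.
  by rewrite ltr_pdivrMr// ltr_pMr// ltr1n.
by move=> s r sh rh; apply: (eP (s, r)); split; exact: le.
Qed.

(** Schwarz's theorem. The second difference of g over a small parallelogram is symmetric in u and
    v; it is h^2 times [guv] at one point and h^2 times [gvu] at another. Both points are close to
    z, where [guv] and [gvu] are continuous. *)
Lemma derive_comm g gu gv guv gvu u v z :
  (\forall y \near z, [/\ is_derive y u g (gu y), is_derive y v g (gv y),
     is_derive y v gu (guv y) & is_derive y u gv (gvu y)]) ->
  {for z, continuous guv} -> {for z, continuous gvu} -> guv z = gvu z.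
Proof.
move=> dg c1 c2; apply/eqP; rewrite -subr_eq0 -normr_le0; apply/ler_addgt0Pl => e e0.
rewrite addr0.
have e2 : 0 < e / 2 by rewrite divr_gt0.
have n1 : \forall y \near z, `|guv z - guv y| <= e / 2.
  by have /cvgrPdist_le/(_ _ e2) := c1.
have n2 : \forall y \near z, `|gvu z - gvu y| <= e / 2.
  by have /cvgrPdist_le/(_ _ e2) := c2.
have [h h0 H] := near_parallelogram u v (filterI dg (filterI n1 n2)).
have M1 (s r : R) : 0 <= s <= h -> 0 <= r <= h ->
    is_derive (s *: u + (r *: v + z)) u g (gu (s *: u + (r *: v + z))) /\
    is_derive (s *: u + (r *: v + z)) v gu (guv (s *: u + (r *: v + z))).
  by move=> sh rh; have [[]] := H s r sh rh.
have [s [r [sh rh E1]]] := mixed_difference h0 M1.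
have cmm (s' r' : R) : r' *: v + (s' *: u + z) = s' *: u + (r' *: v + z).
  exact: addrCA.
have M2 (s' r' : R) : 0 <= s' <= h -> 0 <= r' <= h ->
    is_derive (s' *: v + (r' *: u + z)) v g (gv (s' *: v + (r' *: u + z))) /\
    is_derive (s' *: v + (r' *: u + z)) u gv (gvu (s' *: v + (r' *: u + z))).
  by move=> sh' rh'; rewrite cmm; have [[]] := H r' s' rh' sh'.
have [r' [s' [rh' sh' E2]]] := mixed_difference h0 M2.
have E : guv (s *: u + (r *: v + z)) = gvu (s' *: u + (r' *: v + z)).
  have hn : h != 0 by rewrite gt_eqF.
  apply: (mulfI hn); apply: (mulfI hn).
  (* Exchanging u and v swaps the two middle corners of the parallelogram and leaves the second
     difference unchanged. *)
  have sw (a b c d : R) : a - b - (c - d) = a - c - (b - d) by ring.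
  by rewrite -E1 -[in RHS]cmm -E2 cmm; exact: sw.
have [_ [H1 _]] := H s r sh rh; have [_ [_ H2]] := H s' r' sh' rh'.
rewrite (splitr e).
have sub (a b c : R) : a - b = (a - c) - (b - c) by ring.
rewrite (sub _ _ (guv (s *: u + (r *: v + z)))) [in X in _ - X]E.
by rewrite (le_trans (ler_normB _ _))// lerD.
Qed.

(** Restriction to the line through z reduces this to one variable, so a directional derivative of g
    is enough. *)
Lemma is_derive_chain (phi : R -> R) (g : V -> R) z v (dphi dg : R) :
  is_derive (g z) 1 phi dphi -> is_derive z v g dg ->
  is_derive z v (phi \o g) (dphi * dg).
Proof.
move=> dp dg'; apply: is_derive_line0.
have gE : g (0 *: v + z) = g z by rewrite scale0r add0r.
have dl : is_derive (0 : R) 1 (fun s : R => g (s *: v + z)) dg.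
  by apply: is_derive_line_at; rewrite scale0r add0r.
have dp' : is_derive (g (0 *: v + z)) 1 phi dphi by rewrite gE.
exact: (is_derive1_comp (g := fun s : R => g (s *: v + z))).
Qed.

End mixed_derivatives.

(** * Growth of F near 0 *)

Section antiderivative_bounds.
Context {R : realType}.
Variables (f F : R -> R) (M : R).
Hypothesis hf : {within `[0, +oo[, continuous f}.
Hypothesis hF : is_antiderivative f F.
Hypothesis hF0 : F 0 = 0.

Lemma within_itv_bounded (h : R -> R) (a b : R) : a <= b ->
  {within `[a, b], continuous h} ->
  exists2 C : R, 0 <= C & forall r : R, a <= r <= b -> `|h r| <= C.
Proof.
move=> ab ch.
have [c1 _ H1] := EVT_max ab ch; have [c2 _ H2] := EVT_min ab ch.
exists (`|h c1| + `|h c2|) => // r rab.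
have rI : r \in `[a, b] by rewrite in_itv.
rewrite ler_norml; apply/andP; split.
  rewrite opprD; apply: le_trans (H2 r rI).
  by have := ler_norm (- h c2); have := normr_ge0 (h c1); rewrite normrN; lra.
by apply: le_trans (H1 r rI) _; apply: le_trans (ler_norm _) _; rewrite lerDl.
Qed.

Lemma within_itv_sub (a b : R) : 0 <= a -> {within `[a, b], continuous f}.
Proof.
move=> a0; apply: continuous_subspaceW hf => x /=.
by rewrite !in_itv/= andbT => /andP[ax _]; exact: le_trans ax.
Qed.

(** The difference quotient at 0 converges, and its product with h is F h - F 0. This is the
    endpoint continuity needed by the mean value theorem on [0, r]. *)
Lemma antiderivative_cvg0 : F h @[h --> 0^'+] --> F 0.
Proof.
have [_ c] := hF.
have i0 : id h @[h --> (0 : R)^'+] --> (0 : R).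
  by apply: cvg_at_right_filter; exact: cvg_id.
have c0 : h * (h^-1 * (F h - F 0)) @[h --> (0 : R)^'+] --> 0 * f 0 by exact: cvgM i0 c.
rewrite mul0r in c0.
have : (h * (h^-1 * (F h - F 0)) + F 0) @[h --> (0 : R)^'+] --> 0 + F 0.
  by apply: cvgD => //; exact: cvg_cst.
rewrite add0r; apply: cvg_trans; apply: near_eq_cvg; near=> h.
by rewrite mulrA divff ?mul1r ?subrK// gt_eqF.
Unshelve. all: by end_near. Qed.

(** f is bounded on the compact [0, M], and the mean value theorem turns this into |F r| <= C r. A
    mere bound on F would not do: the linear one makes F(rho) as integrable as rho, with M the
    supremum bound on rho. *)
Lemma antiderivative_bounded :
  exists2 C : R, 0 <= C & forall r : R, 0 < r <= M -> `|f r| <= C /\ `|F r| <= C * r.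
Proof.
have [M0|M0] := ltP M 0.
  by exists 0 => // r /andP[r0 rM]; have := lt_trans (lt_le_trans r0 rM) M0; rewrite ltxx.
have [C C0 fC] := within_itv_bounded M0 (@within_itv_sub 0 M (lexx 0)).
exists C => // r /andP[r0 rM]; split; first by apply: fC; rewrite ltW.
have [dF _] := hF.
have dF' x : x \in `]0, r[ -> is_derive x 1 F (f x).
  by rewrite in_itv/= => /andP[x0 _]; exact: dF.
have cF : {within `[0, r], continuous F}.
  apply/continuous_within_itvP => //; split.
  - move=> x; rewrite in_itv/= => /andP[x0 _].
    by apply: differentiable_continuous; apply/derivable1_diffP; have [] := dF x x0.
  - exact: antiderivative_cvg0.
  - apply: cvg_at_left_filter.
    by apply: differentiable_continuous; apply/derivable1_diffP; have [] := dF r r0.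
have [c + E] := MVT r0 dF' cF.
rewrite in_itv/= => /andP[c0 cr]; move: E; rewrite hF0 !subr0 => ->.
rewrite normrM (gtr0_norm r0) ler_wpM2r ?(ltW r0)// fC//.
by rewrite (ltW c0)/= (le_trans (ltW cr)).
Qed.

End antiderivative_bounds.

(** * Passage from the time set I to a slab *)

Section slab_lemmas.
Context {R : realType} {d : nat}.
Local Notation point := (R * 'rV[R]_d)%type.
Variables (t0 t1 : R) (w g : 'rV[R]_d -> R).
Local Notation bounded := (slab_bounded t0 t1 w g).
Local Notation cont := (slab_continuous t0 t1).
Implicit Types (q : point -> R).

Lemma near_slab t (x : 'rV[R]_d) : t0 < t < t1 ->
  \forall z \near (t, x), t0 < z.1 < t1.
Proof.
move=> tI; have c : z.1 @[z --> (t, x)] --> t by exact: cvg_fst.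
have : \forall u \near t, u \in `]t0, t1[ by apply: near_in_itvoo; rewrite in_itv.
move=> H; near=> z; have : z.1 \in `]t0, t1[ by near: z; exact: (c _ H).
by rewrite in_itv.
Unshelve. all: by end_near. Qed.

Lemma slab_continuous_eq q1 q2 :
  (forall t x, t0 < t < t1 -> q1 (t, x) = q2 (t, x)) -> cont q1 -> cont q2.
Proof.
move=> E c t x tI; have := c t x tI; rewrite /prop_for /continuous_at E//.
apply: cvg_trans; apply: near_eq_cvg; near=> z.
by rewrite [z]surjective_pairing E//; near: z; exact: near_slab.
Unshelve. all: by end_near. Qed.

Lemma slab_bounded_eq m n e q1 q2 :
  (forall t x, t0 < t < t1 -> q1 (t, x) = q2 (t, x)) ->
  bounded m n e q1 -> bounded m n e q2.
Proof. by move=> E [C C0 qC]; exists C => // t x tI; rewrite -E//; exact: qC. Qed.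

Lemma slab_bounded_w q : (forall t x, t0 < t < t1 -> `|q (t, x)| <= w x) ->
  bounded 0 1 0 q.
Proof. by move=> H; exists 1 => // t x tI; rewrite !expr0 expr1 mulr1 !mul1r H. Qed.

Lemma slab_bounded_g q : (forall t x, t0 < t < t1 -> `|q (t, x)| <= g x) ->
  bounded 0 0 1 q.
Proof. by move=> H; exists 1 => // t x tI; rewrite !expr0 expr1 !mul1r H. Qed.

Lemma slab_bounded_sum m n e I (r : seq I) (q : I -> point -> R) :
  (forall i, bounded m n e (q i)) -> bounded m n e (fun z => \sum_(i <- r) q i z).
Proof.
move=> bq; elim: r => [|i r IH].
  by exists 0 => // t x _; rewrite big_nil normr0 mul0r.
by apply: slab_bounded_eq (slab_boundedD (bq i) IH) => t x _; rewrite big_cons.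
Qed.

Lemma Ck_slab k (I : set R) q : (forall t, t0 < t < t1 -> I t) -> Ck k I q -> cont q.
Proof. by move=> tI; case: k => [|k] [cq _] t x /tI /cq. Qed.

Lemma CkS_slab k (I : set R) q a : (forall t, t0 < t < t1 -> I t) -> Ck k.+1 I q ->
  slab_derive t0 t1 a q (pd a q) /\ Ck k I (pd a q).
Proof.
move=> tI [_ /(_ a)[dq cq]]; split => // t x /tI It.
exact/DeriveDef/erefl/dq.
Qed.

End slab_lemmas.

(* Both sides are kept in the shape produced by the product rule [tameM] below. *)
Section algebra.
Context {R : realFieldType} {n : nat}.
Implicit Types (j : 'I_n) (u x m : 'I_n -> R).

Lemma sum_delta j (X : 'I_n -> R) : \sum_k (k == j)%:R * X k = X j.
Proof.
rewrite (bigD1 j)//= eqxx mul1r big1 ?addr0// => k /negPf ->.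
by rewrite mul0r.
Qed.

Section pointwise.
(** Values at one point (t, x): [r], [c], [c'], [K], [f] stand for rho, kappa(rho), kappa'(rho), the
    Korteweg potential and f(rho), and [u] for v. Suffixes are derivatives, the outer one first:
    [rti] is d_t d_i rho, [rit] is d_i d_t rho, and [uij i j] is d_i v_j. *)
Variables (r rt c c' K f : R) (ri rti rit u ut fi Ki : 'I_n -> R).
Variables (rij uij : 'I_n -> 'I_n -> R).
Hypothesis rijC : forall i j, rij i j = rij j i.
Hypothesis rtiC : forall i, rti i = rit i.
Hypothesis KE : K = \sum_i c * rij i i + 2^-1 * \sum_i c' * ri i * ri i.
Hypothesis mass : rt = - \sum_i (ri i * u i + r * uij i i).
Hypothesis vel : forall j, ut j = Ki j - fi j - \sum_i u i * uij i j.

(** In divergence form, K d_j rho = sum_k d_k (kappa d_k rho d_j rho) - d_j (kappa |grad rho|^2) /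
    2; both sums are expanded by the product rule, and symmetry of the second derivatives cancels
    the mixed terms. *)
Lemma korteweg_identity j : K * ri j =
  \sum_k ((c' * ri k * ri k + c * rij k k) * ri j + c * ri k * rij k j)
  - 2^-1 * \sum_l ((c' * ri j * ri l + c * rij j l) * ri l + c * ri l * rij j l).
Proof.
rewrite KE !mulr_sumr -big_split/= mulr_suml -sumrB; apply: eq_bigr => k _.
by rewrite (rijC k j); field.
Qed.

(** The pressure term is rho d_j f(rho) = d_j (rho f(rho) - F(rho)) because F' = f. The capillary
    term is rho d_j K = d_j (rho K) - K d_j rho, whose last product is given by
    [korteweg_identity]. *)
Lemma momentum_identity j :
  rt * u j + r * ut j = - \sum_k
  (((ri k * u k + r * uij k k) * u j + (r * u k) * uij k j)
   + ((c' * ri k * ri k + c * rij k k) * ri j + c * ri k * rij k j)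
   + (k == j)%:R * ((ri k * f + r * fi k) - f * ri k - (ri k * K + r * Ki k)
     - 2^-1 * \sum_l ((c' * ri k * ri l + c * rij k l) * ri l + c * ri l * rij k l))).
Proof.
rewrite mass vel !big_split/= sum_delta [ri j * K]mulrC korteweg_identity.
have -> : \sum_k (r * u k) * uij k j = r * \sum_k u k * uij k j.
  by rewrite mulr_sumr; apply: eq_bigr => k _; rewrite mulrA.
by rewrite !big_split/= -!mulr_suml !big_split/=; ring.
Qed.

(** K is minus the variational derivative of the capillary energy: d_t (kappa |grad rho|^2 / 2) = -
    K d_t rho + div (kappa d_t rho grad rho). Since d_t rho = - div (rho u), the remaining (f - K)
    d_t rho and the work rho u . grad (K - f) add up to - div ((f - K) rho u). *)
Lemma energy_identity :
  2^-1 * (rt * (\sum_j u j * u j) + r * \sum_j (ut j * u j + u j * ut j))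
  + 2^-1 * \sum_l ((c' * rt * ri l + c * rti l) * ri l + c * ri l * rti l) + f * rt
  = \sum_i (- (2^-1 * ((ri i * u i + r * uij i i) * (\sum_j u j * u j)
                       + (r * u i) * \sum_j (uij i j * u j + u j * uij i j))
     + (fi i * (r * u i) + f * (ri i * u i + r * uij i i))
     - (Ki i * (r * u i) + K * (ri i * u i + r * uij i i))
     - ((c' * ri i * ri i + c * rij i i) * rt + c * ri i * rit i))).
Proof.
have SD : \sum_i (ri i * u i + r * uij i i) = - rt by rewrite mass opprK.
set U := \sum_j u j * u j.
(* [A] is rho u . grad |u|^2; [B] and [C] are rho u . grad f(rho) and rho u . grad K; [N + L] is div
   (kappa grad rho); [E] is kappa grad rho . grad d_t rho. *)
pose A := \sum_i (r * u i) * \sum_j (uij i j * u j + u j * uij i j).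
pose B := \sum_i fi i * (r * u i); pose C := \sum_i Ki i * (r * u i).
pose N := \sum_i c' * ri i * ri i; pose L := \sum_i c * rij i i.
pose E := \sum_i c * ri i * rit i.
have KNL : K = L + 2^-1 * N by [].
transitivity (- (2^-1 * ((- rt) * U + A) + (B + f * (- rt)) - (C + K * (- rt))
    - ((N + L) * rt + E))); last first.
  rewrite -SD /A /B /C /N /L /E -big_split/= !(mulr_suml, mulr_sumr) -!big_split/=.
  rewrite !mulr_sumr -!big_split/= -!sumrN -!big_split/= -sumrN.
  by apply: eq_bigr => i _.
have -> : r * \sum_j (ut j * u j + u j * ut j) = 2 * (C - B) - A.
  rewrite /A; under [X in _ = _ - X]eq_bigr do rewrite mulr_sumr.
  rewrite exchange_big/= /C /B -sumrB !mulr_sumr -sumrB; apply: eq_bigr => j _.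
  rewrite vel.
  have -> : \sum_i r * u i * (uij i j * u j + u j * uij i j) =
      2 * r * u j * \sum_i u i * uij i j.
    by rewrite mulr_sumr; apply: eq_bigr => i _; ring.
  by ring.
have -> : \sum_l ((c' * rt * ri l + c * rti l) * ri l + c * ri l * rti l) =
    N * rt + 2 * E.
  rewrite /N /E mulr_suml mulr_sumr -big_split/=; apply: eq_bigr => l _.
  by rewrite rtiC; ring.
by rewrite KNL; field.
Qed.

(** The term - n rho K of the trace contains - n rho kappa times the Laplacian of rho. Adding n div
    (rho kappa grad rho) removes it, and the first-order terms left over combine into n/2 (kappa +
    rho kappa') |grad rho|^2. *)
Lemma virial_source_identity (p N U : R) :
  N = \sum_i ri i * ri i -> U = \sum_i u i * u i ->
  \sum_j ((r * u j) * u j + c * ri j * ri j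
          + (j == j)%:R * (r * f - p - r * K - 2^-1 * \sum_l c * ri l * ri l))
  + n%:R * \sum_i (ri i * (c * ri i) + r * (c' * ri i * ri i + c * rij i i)) =
  2 * (2^-1 * r * U + c / 2 * N + p)
  + (n%:R * (r * f - p) - 2 * p + n%:R / 2 * (c + r * c') * N).
Proof.
move=> NE UE; under eq_bigr do rewrite eqxx mul1r.
rewrite big_split/= sumr_const card_ord -[_ *+ n]mulr_natl !big_split/=.
have -> : \sum_i (r * u i) * u i = r * U.
  by rewrite UE mulr_sumr; apply: eq_bigr => i _; rewrite mulrA.
have Ec (a : R) : \sum_i a * ri i * ri i = a * N.
  by rewrite NE mulr_sumr; apply: eq_bigr => i _; rewrite mulrA.
have -> : \sum_i ri i * (c * ri i) = c * N.
  by rewrite -Ec; apply: eq_bigr => i _; ring.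
by rewrite -mulr_sumr big_split/= KE !Ec; field.
Qed.

End pointwise.

(* Testing the divergence of a tensor T against the linear weight x. *)
Lemma moment_identity (x m mt X : 'I_n -> R) (T DT : 'I_n -> 'I_n -> R) (a s : R) :
  (forall j, mt j = - \sum_k DT k j) -> s = \sum_j T j j + a * \sum_k X k ->
  \sum_j (0 * m j + x j * mt j) =
  s + \sum_k (- (\sum_j ((k == j)%:R * T k j + x j * DT k j)) - a * X k).
Proof.
move=> mtE ->; rewrite sumrB sumrN -mulr_sumr exchange_big/=.
under [\sum_j \sum_k _]eq_bigr do rewrite big_split/= sum_delta -mulr_sumr.
under eq_bigr do rewrite mul0r add0r mtE mulrN.
by rewrite sumrN big_split/=; ring.
Qed.

(** Since d_k (x_i T_kj) = (k == i) T_kj + x_i d_k T_kj, the undifferentiated terms of the two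
    products are T_ij and T_ji, which cancel. *)
Lemma angular_identity (x m mt : 'I_n -> R) (T DT : 'I_n -> 'I_n -> R) (i j : 'I_n) :
  (forall j, mt j = - \sum_k DT k j) -> T i j = T j i ->
  (0 * m j + x i * mt j) - (0 * m i + x j * mt i) =
  0 + \sum_k (- (((k == i)%:R * T k j + x i * DT k j)
                 - ((k == j)%:R * T k i + x j * DT k i))).
Proof.
move=> mtE TC; rewrite sumrN sumrB !big_split/= !sum_delta -!mulr_sumr TC !mtE.
by ring.
Qed.

Lemma first_moment_identity (x m Dm : 'I_n -> R) (r rt : R) (j : 'I_n) :
  rt = - \sum_k Dm k ->
  0 * r + x j * rt = m j + \sum_k (- ((k == j)%:R * m k + x j * Dm k)).
Proof. by move=> ->; rewrite sumrN big_split/= sum_delta -mulr_sumr; ring. Qed.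

(** The factor 2 is that of grad |x|^2 = 2 x; the inner sums are the product rule for |x|^2 = sum_j
    x_j x_j, whose time derivative is 0. *)
Lemma inertia_identity (x m Dm : 'I_n -> R) (r rt : R) :
  rt = - \sum_k Dm k ->
  (\sum_j (0 * x j + x j * 0)) * r + (\sum_j x j * x j) * rt =
  2 * \sum_j x j * m j + \sum_k (- ((\sum_j ((k == j)%:R * x j + x j * (k == j)%:R)) * m k
                                  + (\sum_j x j * x j) * Dm k)).
Proof.
move=> ->; rewrite [X in X * r]big1; last by move=> j _; rewrite mul0r mulr0 addr0.
have -> : \sum_k (- ((\sum_j ((k == j)%:R * x j + x j * (k == j)%:R)) * m k
    + (\sum_j x j * x j) * Dm k)) =
    - (2 * \sum_j x j * m j) - (\sum_j x j * x j) * \sum_k Dm k.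
  rewrite sumrN big_split/= -mulr_sumr -opprD; congr (- (_ + _)).
  rewrite mulr_sumr; apply: eq_bigr => k _.
  rewrite big_split/= (eq_bigr (fun j => (j == k)%:R * x j)); last first.
    by move=> j _; rewrite eq_sym.
  rewrite [X in _ + X](eq_bigr (fun j => (j == k)%:R * x j)); last first.
    by move=> j _; rewrite eq_sym mulrC.
  by rewrite sum_delta; ring.
by ring.
Qed.

End algebra.

(** * The Euler-Korteweg system *)

Section local_balance.
Context {R : realType} {d : nat}.
Local Notation point := (R * 'rV[R]_d)%type.
Local Notation mu := (@lebesgue_Rn R d).
Local Notation dt := (pd None).
Local Notation dx i := (pd (Some i)).
Variables (kappa f F : R -> R) (I : set R).
Variables (rho : point -> R) (v : point -> 'rV[R]_d).
Local Notation vc j := (Defs.comp v j).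
Hypothesis hkappa : forall r : R, 0 < r -> derivable kappa r 1.
Hypothesis hf : {within `[0, +oo[, continuous f}.
Hypothesis hf1 : forall r : R, 0 < r -> derivable f r 1.
Hypothesis hf1c : {in `]0, +oo[, continuous (derive1 f)}.
Hypothesis hF : is_antiderivative f F.
Hypothesis hF0 : F 0 = 0.
Hypothesis hsmooth : smooth_solution I kappa rho v.
Hypothesis hpos : forall t x, I t -> 0 < rho (t, x).
Hypothesis hsol : euler_korteweg I kappa f rho v.
Variables (t0 t1 : R) (w g : 'rV[R]_d -> R) (M : R).
Hypothesis tI : forall t, t0 < t < t1 -> I t.
Hypothesis w_ge1 : forall x, 1 <= w x.
Hypothesis g_ge0 : forall x, 0 <= g x.
Hypothesis integrable_weight : mu.-integrable setT
  (fun x => ((1 + `|rowt x|) ^+ 2 * w (rowt x) ^+ 3 * g (rowt x))%:E).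
Hypothesis rho_le : forall t x, t0 < t < t1 ->
  [/\ `|rho (t, x)| <= M, `|rho (t, x)| <= g x,
      forall a, `|pd a rho (t, x)| <= g x &
      forall a b, `|pd a (pd b rho) (t, x)| <= g x].
Hypothesis v_le : forall t x j, t0 < t < t1 ->
  `|v (t, x) 0 j| <= w x /\ forall a, `|pd a (vc j) (t, x)| <= w x.
Hypothesis capillary_le : forall t x, t0 < t < t1 ->
  [/\ forall a, `|kappa (rho (t, x)) * pd a rho (t, x)| <= w x,
      forall a b, `|kappa (rho (t, x)) * pd a (pd b rho) (t, x)| <= w x,
      forall a b, `|derive1 kappa (rho (t, x)) * pd a rho (t, x) * pd b rho (t, x)|
                  <= w x
    & forall i, `|dx i (korteweg kappa rho) (t, x)| <= w x].

Local Notation K := (korteweg kappa rho).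
Local Notation tame := (tame t0 t1 w g).
Local Notation bounded := (slab_bounded t0 t1 w g).
Local Notation cont := (slab_continuous t0 t1).

Lemma rho_gt0 t x : t0 < t < t1 -> 0 < rho (t, x).
Proof. by move=> /tI; exact: hpos. Qed.

Let Ckrho : Ck 2 I rho. Proof. by have [] := hsmooth. Qed.
Let Ckdrho b : Ck 1 I (pd b rho). Proof. by have [] := CkS_slab b tI Ckrho. Qed.

Lemma tame_rho a : tame a 0 0 1 rho (pd a rho).
Proof.
have [dr _] := CkS_slab a tI Ckrho.
split => //; [exact: Ck_slab Ckrho|exact: Ck_slab (Ckdrho a)| |].
- by apply: slab_bounded_g => t x /(rho_le x)[].
- by apply: slab_bounded_g => t x /(rho_le x)[].
Qed.

Lemma tame_drho a b : tame a 0 0 1 (pd b rho) (pd a (pd b rho)).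
Proof.
have [dr c] := CkS_slab a tI (Ckdrho b).
split => //; [exact: Ck_slab (Ckdrho b)|exact: Ck_slab c| |].
- by apply: slab_bounded_g => t x /(rho_le x)[].
- by apply: slab_bounded_g => t x /(rho_le x)[].
Qed.

Lemma pd_comm a b t x : t0 < t < t1 ->
  pd a (pd b rho) (t, x) = pd b (pd a rho) (t, x).
Proof.
move=> tt; apply: (@derive_comm _ _ rho (pd b rho) (pd a rho) _ _ (dir b) (dir a)).
- near=> z.
  have zt : t0 < z.1 < t1 by near: z; exact: near_slab.
  have [_ _ d1 _ _] := tame_rho a; have [_ _ d2 _ _] := tame_rho b.
  have [_ _ d3 _ _] := tame_drho a b; have [_ _ d4 _ _] := tame_drho b a.
  rewrite (surjective_pairing z).
  by split; [exact: d2|exact: d1|exact: d3|exact: d4].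
- by have [_ c _ _ _] := tame_drho a b; exact: c.
- by have [_ c _ _ _] := tame_drho b a; exact: c.
Unshelve. all: by end_near. Qed.

Lemma tame_v a j : tame a 0 1 0 (vc j) (pd a (vc j)).
Proof.
have Cv : Ck 1 I (vc j) by have [] := hsmooth.
have [dv c] := CkS_slab a tI Cv.
split => //; [exact: Ck_slab Cv|exact: Ck_slab c| |].
- by apply: slab_bounded_w => t x /(v_le x j)[].
- by apply: slab_bounded_w => t x /(v_le x j)[].
Qed.

Let kappa_derive t x a : t0 < t < t1 ->
  is_derive (t, x) (dir a) (kappa \o rho) (derive1 kappa (rho (t, x)) * pd a rho (t, x)).
Proof.
move=> tt; have [_ _ dr _ _] := tame_rho a.
apply: is_derive_chain; last exact: dr.
by rewrite derive1E; apply: DeriveDef => //; exact/hkappa/rho_gt0.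
Qed.

(** The product is treated as one factor of size w, as kappa(rho) has no bound of its own. The
    integrable factor g must then come from a second derivative of rho or rho itself standing next
    to it. *)
Lemma tame_kappa_drho a b : tame a 0 1 0 (fun z => kappa (rho z) * pd b rho z)
  (fun z => derive1 kappa (rho z) * pd a rho z * pd b rho z +
            kappa (rho z) * pd a (pd b rho) z).
Proof.
have Ckappa : Ck 1 I (kappa \o rho) by have [] := hsmooth.
have [_ Cdkappa] := CkS_slab a tI Ckappa.
have [cr c' dr _ _] := tame_drho a b.
have ck := Ck_slab tI Ckappa.
split.
- by move=> t x tt; apply: cvgM; [exact: ck|exact: cr].
- move=> t x tt; apply: cvgD; apply: cvgM; [|exact: cr|exact: ck|exact: c'].
  (* kappa is only differentiable, so [derive1 kappa] may be discontinuous; kappa'(rho) d_a rho is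
     continuous as the derivative of the C^1 function [kappa \o rho]. *)
  apply: (slab_continuous_eq (q1 := pd a (kappa \o rho)) _ (Ck_slab tI Cdkappa) tt).
  by move=> u y ut; have [_ <-] := kappa_derive y a ut.
- move=> t x tt; have d1 := kappa_derive x a tt; have d2 := dr t x tt.
  apply: (is_derive_eq (is_deriveM d1 d2)).
  by rewrite -![_ *: _]/(_ * _) addrC [pd b rho _ * _]mulrC.
- by apply: slab_bounded_w => t x /(capillary_le x)[].
- apply: slab_boundedD.
  + by apply: slab_bounded_w => t x /(capillary_le x)[].
  + by apply: slab_bounded_w => t x /(capillary_le x)[].
Qed.

Lemma korteweg_sum z : K z = \sum_i kappa (rho z) * dx i (dx i rho) z
  + 2^-1 * \sum_i derive1 kappa (rho z) * dx i rho z * dx i rho z.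
Proof.
rewrite /korteweg /laplacian /sqnorm /dot mulr_sumr; congr (_ + _).
rewrite -mulrA; congr (_ * _); rewrite mulr_sumr; apply: eq_bigr => i _.
by rewrite !mxE mulrA.
Qed.

(** Only space derivatives are treated, because K occurs in fluxes alone. *)
Lemma tame_korteweg i : tame (Some i) 0 1 0 K (dx i K).
Proof.
have [_ _ _ CK CdK] := hsmooth; have [dK CdKi] := CdK i.
split.
- exact: Ck_slab CK.
- exact: Ck_slab CdKi.
- move=> t x tt; exact/DeriveDef/erefl/dK/tI.
- apply: (@slab_bounded_eq _ _ _ _ _ _ _ _ _ (fun z =>
    \sum_i kappa (rho z) * dx i (dx i rho) z
    + 2^-1 * \sum_i derive1 kappa (rho z) * dx i rho z * dx i rho z)).
    by move=> t x _; rewrite korteweg_sum.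
  apply: slab_boundedD.
    apply: slab_bounded_sum => j.
    by apply: slab_bounded_w => t x /(capillary_le x)[].
  apply: (slab_boundedM (m := 0) (n := 0) (e := 0) (slab_bounded_cst _ _ _ _ 2^-1)).
  apply: slab_bounded_sum => j.
  by apply: slab_bounded_w => t x /(capillary_le x)[].
- by apply: slab_bounded_w => t x /(capillary_le x)[].
Qed.

Lemma continuous_derivable (h : R -> R) (r : R) : derivable h r 1 -> {for r, continuous h}.
Proof. by move=> dh; apply: differentiable_continuous; apply/derivable1_diffP. Qed.

Let cont_comp (h : R -> R) : (forall r : R, 0 < r -> {for r, continuous h}) -> cont (h \o rho).
Proof.
move=> ch t x tt; apply: continuous_comp; last by apply: ch; exact: rho_gt0.
by have [cr _ _ _ _] := tame_rho None; exact: cr.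
Qed.

Lemma tame_F a : tame a 0 0 1 (F \o rho) (fun z => f (rho z) * pd a rho z).
Proof.
have [cr c' dr br bdr] := tame_rho a; have [dF _] := hF.
have [C C0 fFC] := antiderivative_bounded M hf hF hF0.
have rM t x : t0 < t < t1 -> 0 < rho (t, x) <= M.
  move=> tt; rewrite rho_gt0//=; have [+ _ _ _] := rho_le x tt.
  exact/le_trans/ler_norm.
split.
- by apply: cont_comp => r r0; apply: continuous_derivable; have [] := dF r r0.
- move=> t x tt; apply: cvgM; last exact: c'.
  by apply: (@cont_comp f) => // r r0; exact/continuous_derivable/hf1.
- move=> t x tt; apply: is_derive_chain; last exact: dr.
  by apply: dF; exact: rho_gt0.
- apply: (slab_bounded_le C0 _ br) => t x tt.
  have [_ H] := fFC _ (rM t x tt).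
  by rewrite (ger0_norm (ltW (rho_gt0 x tt))).
- apply: (slab_bounded_le C0 _ bdr) => t x tt.
  by have [H _] := fFC _ (rM t x tt); rewrite normrM ler_wpM2r.
Qed.

Lemma pd_f a t x : t0 < t < t1 ->
  is_derive (t, x) (dir a) (f \o rho) (derive1 f (rho (t, x)) * pd a rho (t, x)).
Proof.
move=> tt; have [_ _ dr _ _] := tame_rho a.
apply: is_derive_chain; last exact: dr.
by rewrite derive1E; apply: DeriveDef => //; exact/hf1/rho_gt0.
Qed.

(* f' may blow up at 0, so grad f(rho) is bounded through the equation. *)
Lemma tame_f i : tame (Some i) 0 2 0 (f \o rho) (dx i (f \o rho)).
Proof.
have [cr c' dr _ _] := tame_rho (Some i).
have [C C0 fFC] := antiderivative_bounded M hf hF hF0.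
have cf' (r : R) : 0 < r -> {for r, continuous (derive1 f)}.
  by move=> r0; apply: hf1c; rewrite in_itv/= r0.
split.
- by apply: cont_comp => r r0; exact/continuous_derivable/hf1.
- apply: (@slab_continuous_eq _ _ t0 t1 (fun z => derive1 f (rho z) * dx i rho z)).
    by move=> t x tt; have [_ <-] := pd_f (Some i) x tt.
  move=> t x tt; apply: cvgM; last exact: c'.
  by apply: (cont_comp cf').
- by move=> t x tt; have [df _] := pd_f (Some i) x tt; exact: DeriveDef.
- exists C => // t x tt; have rM : 0 < rho (t, x) <= M.
    rewrite rho_gt0//=; have [+ _ _ _] := rho_le x tt.
    exact/le_trans/ler_norm.
  have [H _] := fFC _ rM; apply: (le_trans H).
  rewrite !expr0 mulr1 mul1r -[leLHS]mulr1 ler_wpM2l// exprn_ege1//.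
(* The convective term v . grad v is what costs w^2; the factor rho v of the energy flux adds the
   third power. *)
- apply: (@slab_bounded_eq _ _ _ _ _ _ _ _ _ (fun z => dx i K z -
    (dt (vc i) z + \sum_k vc k z * dx k (vc i) z))).
    move=> t x tt; have [/(_ i) + _] := hsol x (tI tt) => /= <-.
    have E (a b : R) : a + b - a = b by ring.
    exact: E.
  have [_ _ _ _ bK] := tame_korteweg i.
  have [_ _ _ _ bt] := tame_v None i.
  apply: slab_boundedD.
    exact: (slab_bounded_weaken w_ge1 g_ge0 _ _ bK).
  apply: slab_boundedN; apply: slab_boundedD.
    exact: (slab_bounded_weaken w_ge1 g_ge0 _ _ bt).
  apply: slab_bounded_sum => k.
  have [_ _ _ bv _] := tame_v None k.
  have [_ _ _ _ bx] := tame_v (Some k) i.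
  exact: (slab_boundedM bv bx).
Qed.

Local Notation kd b := (fun z => kappa (rho z) * pd b rho z).
Local Notation kd' a b := (fun z => derive1 kappa (rho z) * pd a rho z * pd b rho z +
  kappa (rho z) * pd a (pd b rho) z).

(** * Mass flux, stress tensor and the equations in conservative form *)

Definition mass_flux (k : 'I_d) : point -> R := fun z => rho z * vc k z.
Definition pd_mass_flux a (k : 'I_d) : point -> R :=
  fun z => pd a rho z * vc k z + rho z * pd a (vc k) z.

Definition isotropic_stress : point -> R := fun z =>
  rho z * f (rho z) - F (rho z) - rho z * K z
  - 2^-1 * \sum_l kd (Some l) z * dx l rho z.
Definition dx_isotropic_stress (k : 'I_d) : point -> R := fun z =>
  (dx k rho z * f (rho z) + rho z * dx k (f \o rho) z) - f (rho z) * dx k rho z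
  - (dx k rho z * K z + rho z * dx k K z)
  - 2^-1 * \sum_l (kd' (Some k) (Some l) z * dx l rho z
                   + kd (Some l) z * dx k (dx l rho) z).

Definition stress (k j : 'I_d) : point -> R := fun z =>
  mass_flux k z * vc j z + kd (Some k) z * dx j rho z + (k == j)%:R * isotropic_stress z.
Definition dx_stress (k j : 'I_d) : point -> R := fun z =>
  (pd_mass_flux (Some k) k z * vc j z + mass_flux k z * dx k (vc j) z)
  + (kd' (Some k) (Some k) z * dx j rho z + kd (Some k) z * dx k (dx j rho) z)
  + (k == j)%:R * dx_isotropic_stress k z.

Lemma tame_mass_flux a k : tame a 0 1 1 (mass_flux k) (pd_mass_flux a k).
Proof. exact: tameM (tame_rho a) (tame_v a k). Qed.

Lemma tame_isotropic_stress k :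
  tame (Some k) 0 2 1 isotropic_stress (dx_isotropic_stress k).
Proof.
have wk m n e q q' := @tame_weaken R d t0 t1 w g w_ge1 g_ge0 (Some k) m n e 0 2 q q'.
apply: tameB; first apply: tameB; first apply: tameB.
- exact: (tameM (tame_rho (Some k)) (tame_f k)).
- by apply: wk (tame_F (Some k)).
- by apply: wk (tameM (tame_rho (Some k)) (tame_korteweg k)).
- apply: tameZ; apply: tame_sum => l.
  by apply: wk (tameM (tame_kappa_drho (Some k) (Some l)) (tame_drho (Some k) (Some l))).
Qed.

Lemma tame_stress k j : tame (Some k) 0 2 1 (stress k j) (dx_stress k j).
Proof.
have wk m n e q q' := @tame_weaken R d t0 t1 w g w_ge1 g_ge0 (Some k) m n e 0 2 q q'.
apply: tameD; first apply: tameD.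
- exact: (tameM (tame_mass_flux (Some k) k) (tame_v (Some k) j)).
- by apply: wk (tameM (tame_kappa_drho (Some k) (Some k)) (tame_drho (Some k) (Some j))).
- exact: (tameZ (k == j)%:R (tame_isotropic_stress k)).
Qed.

Lemma mass_equation t x : t0 < t < t1 ->
  dt rho (t, x) = - \sum_k pd_mass_flux (Some k) k (t, x).
Proof.
move=> tt; apply/eqP; rewrite -addr_eq0; apply/eqP.
have [_ E] := hsol x (tI tt); apply: etrans E; congr (_ + _); apply: eq_bigr => k _.
have -> : Defs.comp (fun z => rho z *: v z) k = mass_flux k.
  by apply/funext => z; rewrite /Defs.comp mxE.
by have [_ _ dm _ _] := tame_mass_flux (Some k) k; have [_ <-] := dm _ x tt.
Qed.

Lemma velocity_equation t x j : t0 < t < t1 ->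
  dt (vc j) (t, x) = dx j K (t, x) - dx j (f \o rho) (t, x)
    - \sum_i vc i (t, x) * dx i (vc j) (t, x).
Proof.
move=> tt; have [/(_ j) <- _] := hsol x (tI tt) => /=.
have E (a b c : R) : a = a + b + c - c - b by ring.
exact: E.
Qed.

Lemma momentum_equation t x j : t0 < t < t1 ->
  pd_mass_flux None j (t, x) = - \sum_k dx_stress k j (t, x).
Proof.
move=> tt; exact: (momentum_identity (ri := fun i => dx i rho (t, x))
  (u := fun i => vc i (t, x)) (ut := fun i => dt (vc i) (t, x))
  (fi := fun i => dx i (f \o rho) (t, x)) (Ki := fun i => dx i K (t, x))
  (rij := fun i j => dx i (dx j rho) (t, x)) (uij := fun i j => dx i (vc j) (t, x))
  (f (rho (t, x))) (fun i j => pd_comm (Some i) (Some j) x tt) (korteweg_sum (t, x))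
  (mass_equation x tt) (fun j => velocity_equation x j tt) j).
Qed.

(** * Balance laws of the seven quantities *)

Let wk a m n q q' : tame a m n 1 q q' -> (m <= 2)%N -> (n <= 3)%N -> tame a 2 3 1 q q'.
Proof. by move=> H m2 n3; exact: tame_weaken H. Qed.

Let balance q q' s (J J' : 'I_d -> point -> R) t :=
  @balance_law R d t0 t1 w g w_ge1 g_ge0 integrable_weight q q' s J J' t.

Lemma int_Rn0 : int_Rn (fun _ : 'rV[R]_d => 0) = 0.
Proof. by rewrite /int_Rn Rintegral_cst// mul0r. Qed.

Lemma mass_balance t : t0 < t < t1 ->
  is_derive t 1 (fun t => int_Rn (fun x => rho (t, x))) 0.
Proof.
move=> tt; rewrite -[X in is_derive _ _ _ X]int_Rn0.
have [] // := balance (s := fun=> 0) tt (wk (tame_rho None) isT isT)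
  (fun k => wk (tameN (tame_mass_flux (Some k) k)) isT isT).
by move=> x; apply: etrans (esym (add0r _)); rewrite sumrN; exact: mass_equation.
Qed.

Lemma momentum_balance j t : t0 < t < t1 ->
  is_derive t 1 (fun t => int_Rn (fun x => mass_flux j (t, x))) 0.
Proof.
move=> tt; rewrite -[X in is_derive _ _ _ X]int_Rn0.
have [] // := balance (s := fun=> 0) tt (wk (tame_mass_flux None j) isT isT)
  (fun k => wk (tameN (tame_stress k j)) isT isT).
by move=> x; apply: etrans (esym (add0r _)); rewrite sumrN; exact: momentum_equation.
Qed.

Lemma stress_sym i j z : stress i j z = stress j i z.
Proof.
have E (r k ui uj ri rj D : R) (b b' : bool) : b = b' ->
    r * ui * uj + k * ri * rj + b%:R * D = r * uj * ui + k * rj * ri + b'%:R * D.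
  by move=> ->; ring.
exact: (E _ _ _ _ _ _ _ _ _ (eq_sym i j)).
Qed.

Lemma angular_balance i j t : t0 < t < t1 ->
  is_derive t 1 (fun t => int_Rn (fun x =>
    x 0 i * mass_flux j (t, x) - x 0 j * mass_flux i (t, x))) 0.
Proof.
move=> tt; rewrite -[X in is_derive _ _ _ X]int_Rn0.
have Tq := tameB (tameM (tame_coord t0 t1 w g None i) (tame_mass_flux None j))
  (tameM (tame_coord t0 t1 w g None j) (tame_mass_flux None i)).
have TJ k := tameN (tameB (tameM (tame_coord t0 t1 w g (Some k) i) (tame_stress k j))
  (tameM (tame_coord t0 t1 w g (Some k) j) (tame_stress k i))).
have [] // := balance (s := fun=> 0) tt (wk Tq isT isT) (fun k => wk (TJ k) isT isT).
move=> x; exact: (angular_identity (T := fun k j => stress k j (t, x))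
  (fun i => x 0 i) (fun j => mass_flux j (t, x))
  (fun j => momentum_equation x j tt) (stress_sym i j (t, x))).
Qed.

Lemma first_moment_balance j t : t0 < t < t1 ->
  is_derive t 1 (fun t => int_Rn (fun x => x 0 j * rho (t, x)))
    (int_Rn (fun x => mass_flux j (t, x))).
Proof.
move=> tt.
have Tq := tameM (tame_coord t0 t1 w g None j) (tame_rho None).
have TJ k := tameN (tameM (tame_coord t0 t1 w g (Some k) j) (tame_mass_flux (Some k) k)).
have [] // := balance (s := mass_flux j) tt (wk Tq isT isT) (fun k => wk (TJ k) isT isT).
move=> x; exact: (first_moment_identity (fun i => x 0 i) (fun j => mass_flux j (t, x))
  (rho (t, x)) j (mass_equation x tt)).
Qed.

Definition virial_density : point -> R := fun z => \sum_j z.2 0 j * mass_flux j z.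

Let tame_virial_density := tame_sum (index_enum 'I_d) (fun j =>
  tameM (tame_coord t0 t1 w g None j) (tame_mass_flux None j)).

Lemma inertia_balance t : t0 < t < t1 ->
  is_derive t 1 (fun t => int_Rn (fun x => (\sum_j x 0 j * x 0 j) * rho (t, x)))
    (2 * int_Rn (fun x => \sum_j x 0 j * mass_flux j (t, x))).
Proof.
move=> tt.
have Tx a := tame_sum (index_enum 'I_d) (fun j =>
  tameM (tame_coord t0 t1 w g a j) (tame_coord t0 t1 w g a j)).
have Tq := tameM (Tx None) (tame_rho None).
have TJ k := tameN (tameM (Tx (Some k)) (tame_mass_flux (Some k) k)).
have [|_] := balance (s := fun z => 2 * virial_density z) tt (wk Tq isT isT)
  (fun k => wk (TJ k) isT isT).
  move=> x; exact: (inertia_identity (fun i => x 0 i) (fun j => mass_flux j (t, x))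
    (rho (t, x)) (mass_equation x tt)).
rewrite [X in is_derive _ _ _ X -> _]RintegralZl//.
have [cV _ _ bV _] := tame_virial_density.
exact: integrable_slab tt cV (slab_bounded_weaken w_ge1 g_ge0 _ _ bV).
Qed.

(** The integrand of [energy], regrouped so that kappa(rho) is attached to a derivative of rho and
    every factor is tame. *)
Definition energy_density : point -> R := fun z =>
  2^-1 * (rho z * \sum_j vc j z * vc j z) + 2^-1 * \sum_l kd (Some l) z * dx l rho z
  + F (rho z).

Let tame_energy_density :=
  let Tu a := tame_sum (index_enum 'I_d) (fun j => tameM (tame_v a j) (tame_v a j)) in
  tameD (tameD
    (wk (tameZ 2^-1 (tameM (tame_rho None) (Tu None))) isT isT)
    (wk (tameZ 2^-1 (tame_sum (index_enum 'I_d) (fun l =>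
       tameM (tame_kappa_drho None (Some l)) (tame_drho None (Some l))))) isT isT))
    (wk (tame_F None) isT isT).

Lemma energy_balance t : t0 < t < t1 ->
  is_derive t 1 (fun t => int_Rn (fun x => energy_density (t, x))) 0.
Proof.
move=> tt; rewrite -[X in is_derive _ _ _ X]int_Rn0.
have Tu a := tame_sum (index_enum 'I_d) (fun j => tameM (tame_v a j) (tame_v a j)).
have TJ i := tameN (tameB (tameB (tameD
  (wk (tameZ 2^-1 (tameM (tame_mass_flux (Some i) i) (Tu (Some i)))) isT isT)
  (wk (tameM (tame_f i) (tame_mass_flux (Some i) i)) isT isT))
  (wk (tameM (tame_korteweg i) (tame_mass_flux (Some i) i)) isT isT))
  (wk (tameM (tame_kappa_drho (Some i) (Some i)) (tame_drho (Some i) None)) isT isT)).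
have [] // := balance (s := fun=> 0) tt tame_energy_density TJ.
move=> x; apply: etrans (esym (add0r _)).
exact: (energy_identity (ri := fun i => dx i rho (t, x))
  (u := fun i => vc i (t, x)) (ut := fun i => dt (vc i) (t, x))
  (fi := fun i => dx i (f \o rho) (t, x)) (Ki := fun i => dx i K (t, x))
  (rij := fun i j => dx i (dx j rho) (t, x)) (uij := fun i j => dx i (vc j) (t, x))
  (f (rho (t, x))) (fun i => pd_comm None (Some i) x tt) (korteweg_sum (t, x))
  (mass_equation x tt) (fun j => velocity_equation x j tt)).
Qed.

Definition source_density : point -> R := fun z =>
  2 * energy_density z +
  (d%:R * (rho z * f (rho z) - F (rho z)) - 2 * F (rho z)
   + d%:R / 2 * (kappa (rho z) + rho z * derive1 kappa (rho z))
     * \sum_i dx i rho z * dx i rho z).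

(** The two integrability claims serve to split the integral of the source into 2 H and
    [virial_source]. *)
Lemma virial_balance t : t0 < t < t1 ->
  mu.-integrable setT (EFin \o (fun x => energy_density (t, rowt x))) /\
  (mu.-integrable setT (EFin \o (fun x => source_density (t, rowt x))) /\
  is_derive t 1 (fun t => int_Rn (fun x => virial_density (t, x)))
    (int_Rn (fun x => source_density (t, x)))).
Proof.
move=> tt; split.
  by have [cE _ _ bE _] := tame_energy_density; exact: integrable_slab tt cE bE.
have TJ k := tameB
  (wk (tameN (tame_sum (index_enum 'I_d) (fun j =>
    tameM (tame_coord t0 t1 w g (Some k) j) (tame_stress k j)))) isT isT)
  (wk (tameZ d%:R (tameM (tame_rho (Some k)) (tame_kappa_drho (Some k) (Some k)))) isT isT).
apply: (balance tt (wk tame_virial_density isT isT) TJ) => x.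
apply: (moment_identity (fun i => x 0 i) (fun j => mass_flux j (t, x))
  (fun j => momentum_equation x j tt)).
apply/esym; apply: etrans.
  exact: (virial_source_identity (ri := fun i => dx i rho (t, x))
    (u := fun i => vc i (t, x)) (rij := fun i j => dx i (dx j rho) (t, x))
    (rho (t, x)) (f (rho (t, x))) (korteweg_sum (t, x)) (F (rho (t, x))) erefl erefl).
have E (r k U p q : R) (h : 'I_d -> R) :
    2 * (2^-1 * r * U + k / 2 * \sum_i h i * h i + p) + q =
    2 * (2^-1 * (r * U) + 2^-1 * \sum_i k * h i * h i + p) + q.
  have -> : \sum_i k * h i * h i = k * \sum_i h i * h i.
    by rewrite mulr_sumr; apply: eq_bigr => i _; rewrite mulrA.
  by field.
exact: E.
Qed.

End local_balance.

(** * From balance laws to the theorem *)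

Section conclusion.
Context {R : realType}.

Lemma conserved_derive0 (I : set R) (q : R -> R) : is_interval I ->
  (forall t, I t -> is_derive t 1 q 0) -> conserved I q.
Proof.
move=> iI dq.
have le (s t : R) : s <= t -> I s -> I t -> q s = q t.
  move=> st Is It.
  have sub u : u \in `[s, t] -> I u by rewrite in_itv; exact: iI.
  have dl u : u \in `]s, t[ -> is_derive u 1 q ((fun=> 0) u).
    by move=> us; apply: dq; apply: sub; exact: subset_itv_oo_cc us.
  have cl : {within `[s, t], continuous q}.
    by apply: derivable_within_continuous => u /sub /dq[].
  have [_ _ /eqP] := MVT_segment st dl cl.
  by rewrite mul0r subr_eq0 => /eqP.
move=> s t Is It; have [st|/ltW ts] := leP s t; first exact: le.
exact/esym/le.
Qed.

Lemma conserved_mx m n (I : set R) (q : R -> 'M[R]_(m, n)) :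
  (forall i j, conserved I (fun t => q t i j)) -> conserved I q.
Proof. by move=> cq s t Is It; apply/matrixP => i j; exact: cq. Qed.

Lemma is_derive_row n (q : R -> 'rV[R]_n) (l : 'rV[R]_n) (t : R) :
  (forall j, is_derive t 1 (fun t => q t 0 j) (l 0 j)) -> is_derive t 1 q l.
Proof.
move=> dq; have dd : derivable q t 1.
  by apply/derivable_mxP => i j; rewrite ord1; have [] := dq j.
apply: DeriveDef => //; rewrite derive_mx//; apply/rowP => j.
by rewrite mxE; have [_ ->] := dq j.
Qed.

(** Integrability of b is deduced by subtracting c a from the integrable sum. *)
Lemma int_RnD_scale d (c : R) (a b : 'rV[R]_d -> R) :
  (@lebesgue_Rn R d).-integrable setT (EFin \o (fun x => a (rowt x))) ->
  (@lebesgue_Rn R d).-integrable setT (EFin \o (fun x => c * a (rowt x) + b (rowt x))) ->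
  int_Rn (fun x => c * a x + b x) = c * int_Rn a + int_Rn b.
Proof.
move=> ia iab.
have ica : (@lebesgue_Rn R d).-integrable setT (EFin \o (fun x => c * a (rowt x))).
  have -> : EFin \o (fun x => c * a (rowt x)) =
      (fun x => c%:E * (EFin \o (fun x => a (rowt x))) x)%E.
    by apply/funext => x /=; rewrite EFinM.
  exact: integrableZl.
have -> : int_Rn b = int_Rn (fun x => (c * a x + b x) - c * a x).
  by congr int_Rn; apply/funext => x; rewrite addrAC subrr add0r.
rewrite /int_Rn [X in _ = _ + X]RintegralB// [X in _ = _ + (_ - X)]RintegralZl//.
by rewrite addrC subrK.
Qed.

Lemma open_itv_nbhs (I : set R) (t : R) : open I -> I t ->
  exists t0 t1, t0 < t < t1 /\ `[t0, t1]%classic `<=` I.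
Proof.
move=> oI It; have /nbhs_ballP[e /= e0 eI] := open_nbhs_nbhs (conj oI It).
(* Half the radius keeps the closed interval inside the open ball; the decay hypothesis speaks of
   closed intervals. *)
exists (t - e / 2), (t + e / 2); split.
  by apply/andP; split; lra.
move=> u; rewrite /= in_itv/= => /andP[ut tu]; apply: eI.
rewrite /ball/= ltr_norml; apply/andP; split; lra.
Qed.

Lemma derive1_mulid (h : R -> R) (r : R) : derivable h r 1 ->
  derive1 (fun r => r * h r) r = h r + r * derive1 h r.
Proof.
move=> dh; have [_ E] := is_deriveM (is_derive_id r 1) (DeriveDef dh erefl).
by rewrite derive1E [LHS]E derive1E addrC -![_ *: _]/(_ * _) mulr1.
Qed.

End conclusion.

Unset Implicit Arguments.

Theorem theoremA1 (R : realType) (d : nat) (kappa f F : R -> R) (I : set R)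
    (rho : R * 'rV[R]_d -> R) (v : R * 'rV[R]_d -> 'rV[R]_d)
    (hkappa : forall r : R, 0 < r -> derivable kappa r 1)
    (hf : {within `[0, +oo[, continuous f})
    (hf1 : forall r : R, 0 < r -> derivable f r 1)
    (hf1c : {in `]0, +oo[, continuous (derive1 f)})
    (hF : is_antiderivative f F) (hF0 : F 0 = 0)
    (hIo : open I) (hI : is_interval I)
    (hsmooth : smooth_solution I kappa rho v)
    (hdecay : decaying_solution I kappa rho v)
    (hpos : forall t x, I t -> 0 < rho (t, x))
    (hsol : euler_korteweg I kappa f rho v) :
  conserved I (mass rho) /\
  conserved I (momentum rho v) /\
  conserved I (angular_momentum rho v) /\
  (forall t : R, I t -> is_derive t 1 (first_moment rho) (momentum rho v t)) /\
  (forall t : R, I t -> is_derive t 1 (inertia rho) (virial rho v t)) /\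
  conserved I (energy rho v kappa F) /\
  (forall t : R, I t ->
     is_derive t 1 (virial rho v)
       (2 * energy rho v kappa F t + virial_source rho kappa f F t)).
Proof.
have mfE s x j : (rho (s, x) *: v (s, x)) 0 j = mass_flux rho v j (s, x).
  by rewrite mxE.
have sqE s x : sqnorm (grad rho (s, x)) = \sum_i pd (Some i) rho (s, x) * pd (Some i) rho (s, x).
  by apply: eq_bigr => i _; rewrite !mxE.
have enE s x : 2^-1 * rho (s, x) * sqnorm (v (s, x))
    + kappa (rho (s, x)) / 2 * sqnorm (grad rho (s, x)) + F (rho (s, x)) =
    energy_density kappa F rho v (s, x).
  rewrite sqE /energy_density.
  have E (r k U p : R) (h : 'I_d -> R) :
      2^-1 * r * U + k / 2 * (\sum_i h i * h i) + p =
      2^-1 * (r * U) + 2^-1 * (\sum_i k * h i * h i) + p.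
    have -> : \sum_i k * h i * h i = k * \sum_i h i * h i.
      by rewrite mulr_sumr; apply: eq_bigr => i _; rewrite mulrA.
    by field.
  exact: E.
have viE s x : rho (s, x) * dot x (v (s, x)) = virial_density rho v (s, x).
  rewrite /dot mulr_sumr; apply: eq_bigr => i _.
  have E (a b c : R) : a * (b * c) = b * (a * c) by ring.
  exact: E.
(* Derivatives are local in time: all laws at t are read on a slab around t, and w, g and M may
   depend on that slab. *)
have L t : I t ->
  [/\ is_derive t 1 (mass rho) 0,
      forall j, is_derive t 1 (fun t => int_Rn (fun x => mass_flux rho v j (t, x))) 0,
      forall i j, is_derive t 1 (fun t => int_Rn (fun x =>
        x 0 i * mass_flux rho v j (t, x) - x 0 j * mass_flux rho v i (t, x))) 0,
      forall j, is_derive t 1 (fun t => int_Rn (fun x => x 0 j * rho (t, x)))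
        (int_Rn (fun x => mass_flux rho v j (t, x))) &
  [/\ is_derive t 1 (fun t => int_Rn (fun x => (\sum_j x 0 j * x 0 j) * rho (t, x)))
        (2 * int_Rn (fun x => virial_density rho v (t, x))),
      is_derive t 1 (fun t => int_Rn (fun x => energy_density kappa F rho v (t, x))) 0 &
      is_derive t 1 (fun t => int_Rn (fun x => virial_density rho v (t, x)))
        (2 * energy rho v kappa F t + virial_source rho kappa f F t)]].
  move=> It; have [t0 [t1 [tt tI]]] := open_itv_nbhs hIo It.
  have [w [g [M [iw w1 bd]]]] := hdecay t0 t1 tI.
  have inI u : t0 < u < t1 -> u \in `[t0, t1].
    by move=> /andP[tu ut]; rewrite in_itv/= (ltW tu) (ltW ut).
  have tI' u : t0 < u < t1 -> I u by move=> /inI ui; apply: tI; rewrite /= ui.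
  have g0 x : 0 <= g x.
    by have [_ [H _ _] _ _] := bd t x (inI t tt); exact: le_trans H.
  have rho_le u x : t0 < u < t1 ->
    [/\ `|rho (u, x)| <= M, `|rho (u, x)| <= g x,
      forall a, `|pd a rho (u, x)| <= g x &
      forall a b, `|pd a (pd b rho) (u, x)| <= g x].
    by move=> ut; have [? [? ? ?] _ _] := bd u x (inI u ut); split.
  have v_le u x j : t0 < u < t1 ->
    `|v (u, x) 0 j| <= w x /\ forall a, `|pd a (Defs.comp v j) (u, x)| <= w x.
    by move=> ut; have [_ _ H _] := bd u x (inI u ut); exact: H.
  have cap_le u x (ut : t0 < u < t1) := let: And4 _ _ _ H := bd u x (inI u ut) in H.
  split.
  - exact: (mass_balance hsmooth hsol tI' w1 g0 iw rho_le v_le tt).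
  - move=> j; exact: (momentum_balance hkappa hf hf1 hf1c hF hF0 hsmooth hpos hsol
        tI' w1 g0 iw rho_le v_le cap_le j tt).
  - move=> i j; exact: (angular_balance hkappa hf hf1 hf1c hF hF0 hsmooth hpos hsol
        tI' w1 g0 iw rho_le v_le cap_le i j tt).
  - move=> j; exact: (first_moment_balance hsmooth hsol tI' w1 g0 iw rho_le v_le j tt).
  - split.
    + exact: (inertia_balance hsmooth hsol tI' w1 g0 iw rho_le v_le tt).
    + exact: (energy_balance hkappa hf hf1 hf1c hF hF0 hsmooth hpos hsol
        tI' w1 g0 iw rho_le v_le cap_le tt).
    + have [ie [iS dv]] := virial_balance hkappa hf hf1 hf1c hF hF0 hsmooth hpos hsol
        tI' w1 g0 iw rho_le v_le cap_le tt.
      apply: (is_derive_eq dv).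
      rewrite (_ : energy rho v kappa F t =
          int_Rn (fun x => energy_density kappa F rho v (t, x))); last first.
        by congr int_Rn; apply/funext => x; exact: enE.
      rewrite (_ : virial_source rho kappa f F t = int_Rn (fun x =>
        d%:R * (rho (t, x) * f (rho (t, x)) - F (rho (t, x))) - 2 * F (rho (t, x))
        + d%:R / 2 * (kappa (rho (t, x)) + rho (t, x) * derive1 kappa (rho (t, x)))
          * \sum_i pd (Some i) rho (t, x) * pd (Some i) rho (t, x))); last first.
        rewrite /virial_source; congr int_Rn; apply/funext => x /=.
        by rewrite derive1_mulid ?sqE//; exact/hkappa/hpos.
      exact: int_RnD_scale ie iS.
split; first by apply: conserved_derive0 => // t /L[].
split.
  apply: conserved_mx => i j; apply: conserved_derive0 => // t /L[_ H _ _ _].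
  have -> : (fun t => momentum rho v t i j) = fun t => int_Rn (fun x => mass_flux rho v j (t, x)).
    by apply/funext => s; rewrite mxE; congr int_Rn; apply/funext => x; exact: mfE.
  exact: H.
split.
  apply: conserved_mx => i j; apply: conserved_derive0 => // t /L[_ _ H _ _].
  have -> : (fun t => angular_momentum rho v t i j) = fun t => int_Rn (fun x =>
        x 0 i * mass_flux rho v j (t, x) - x 0 j * mass_flux rho v i (t, x)).
    by apply/funext => s; rewrite mxE; congr int_Rn; apply/funext => x; rewrite mxE !mfE.
  exact: H.
split.
  move=> t /L[_ _ _ H _]; apply: is_derive_row => j.
  have -> : (fun t => first_moment rho t 0 j) = fun t => int_Rn (fun x => x 0 j * rho (t, x)).
    by apply/funext => s; rewrite mxE; congr int_Rn; apply/funext => x; rewrite mxE mulrC.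
  have -> : momentum rho v t 0 j = int_Rn (fun x => mass_flux rho v j (t, x)).
    by rewrite mxE; congr int_Rn; apply/funext => x; exact: mfE.
  exact: H.
have vE : virial rho v = fun t => int_Rn (fun x => virial_density rho v (t, x)).
  by apply/funext => s; congr int_Rn; apply/funext => x; exact: viE.
split.
  move=> t /L[_ _ _ _ [H _ _]]; rewrite vE.
  (* The factor 1/2 of [inertia] cancels the 2 of grad |x|^2 = 2 x. *)
  apply: (is_derive_eq (is_deriveZ 2^-1 H)).
  by rewrite -[_ *: _]/(_ * _) mulrA mulVf ?mul1r.
split.
  apply: conserved_derive0 => // t /L[_ _ _ _ [_ H _]].
  have -> : energy rho v kappa F = fun t => int_Rn (fun x => energy_density kappa F rho v (t, x)).
    by apply/funext => s; congr int_Rn; apply/funext => x; exact: enE.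
  exact: H.
by move=> t /L[_ _ _ _ [_ _ H]]; rewrite vE.
Qed.
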